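(* Let $n\ge 1$, let $z_1,\dots,z_m$ be distinct points of $\mathbb{B}^n$ and let $w_1,\dots,w_m\in\mathbb{D}$. If there exists a function in $\mathcal{S}(\mathbb{B}^n)$ taking the value $w_i$ at $z_i$ for all $i=1,\dots,m$, then there exists an extremal function $\varphi\in\mathcal{E}(\mathbb{B}^n)$ such that $\varphi(z_i)=w_i$ for all $i=1,\dots,m$.
   Context: $\mathbb{B}^n$ is the open unit ball of $\mathbb{C}^n$, $\mathbb{D}=\mathbb{B}^1$. $H^\infty(\mathbb{B}^n)$ is the algebra of bounded analytic functions on $\mathbb{B}^n$ with norm $\|\varphi\|_\infty=\sup_{z\in\mathbb{B}^n}|\varphi(z)|$, and $\mathcal{S}(\mathbb{B}^n)=\{\varphi\in H^\infty(\mathbb{B}^n):\|\varphi\|_\infty\le 1\}$. Interpolation data are a pair $(\mathcal{Z},\mathcal{W})$ with $\mathcal{Z}=\{z_i\}_{i=1}^m$ distinct points of $\mathbb{B}^n$ and $\mathcal{W}=\{w_i\}_{i=1}^m$ scalars in $\mathbb{D}$ (not necessarily distinct). A function $\varphi\in\mathcal{S}(\mathbb{B}^n)$ interpolates the data if $\varphi(z_i)=w_i$ for all $i$. The data solve the extremal problem if at least one $\varphi\in\mathcal{S}(\mathbb{B}^n)$ interpolates them and every $\varphi\in\mathcal{S}(\mathbb{B}^n)$ interpolating them satisfies $\|\varphi\|_\infty=1$. $\mathcal{E}(\mathbb{B}^n)$, the set of extremal functions, is the set of all $\varphi\in\mathcal{S}(\mathbb{B}^n)$ that interpolate some interpolation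 data (with any finite number of nodes) which solve the extremal problem. *)

(* Defs.v *)
From HB Require Import structures.
From mathcomp Require Import all_boot all_order all_algebra.
From mathcomp Require Import all_classical all_reals all_analysis.
From mathcomp Require Export complex.

Set Implicit Arguments.
Unset Strict Implicit.
Unset Printing Implicit Defensive.

Import Order.TTheory GRing.Theory Num.Theory numFieldNormedType.Exports.

Local Open Scope classical_set_scope.
Local Open Scope ring_scope.

(* The modulus as an element of R: the norm `|x| of x : R[i] lives in R[i],
   where the order is only partial and [sup] is not available. *)
Notation cmod := Normc.normc (only parsing).

Definition unit_disc (R : realType) : set R[i] := [set x | cmod x < 1].

Definition unit_ball (R : realType) (n : nat) : set 'rV[R[i]]_n :=
  [set z | \sum_(i < n) cmod (z 0 i) ^+ 2 < 1].

Definition monomial (R : realType) (n : nat) (a : {ffun 'I_n -> nat})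
  (h : 'rV[R[i]]_n) : R[i] := \prod_(i < n) h 0 i ^+ a i.

Definition multi_index_of (n N : nat) (a : {ffun 'I_n -> 'I_N}) :
  {ffun 'I_n -> nat} := [ffun i => nat_of_ord (a i)].

(* The series \sum_a c_a h^a over all multi-indices a converges absolutely, with
   sum s.  Absolute convergence makes the order of summation irrelevant; here
   it is taken along the cubes {0, ..., N-1}^n.  The alias R[i]^o selects the
   topology of the modulus on R[i]. *)
Definition power_series_sums_to (R : realType) (n : nat)
    (c : {ffun 'I_n -> nat} -> R[i]) (h : 'rV[R[i]]_n) (s : R[i]) : Prop :=
  summable [set: {ffun 'I_n -> nat}] (fun a => (cmod (c a * monomial a h))%:E)
  /\ (fun N : nat => \sum_(a : {ffun 'I_n -> 'I_N})
        c (multi_index_of a) * monomial (multi_index_of a) h : R[i]^o)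
       @ \oo --> (s : R[i]^o).

Definition analytic_at (R : realType) (n : nat) (f : 'rV[R[i]]_n -> R[i])
    (z : 'rV[R[i]]_n) : Prop :=
  exists (c : {ffun 'I_n -> nat} -> R[i]) (r : R), 0 < r /\
    forall h : 'rV[R[i]]_n, (forall i, cmod (h 0 i) < r) ->
      power_series_sums_to c h (f (z + h)).

(* Functions on the ball are represented by total functions whose values
   outside the ball are irrelevant (the radius r above may be shrunk). *)
Definition Hoo (R : realType) (n : nat) : set ('rV[R[i]]_n -> R[i]) :=
  [set f | (forall z, unit_ball z -> analytic_at f z) /\
           exists M : R, forall z, unit_ball z -> cmod (f z) <= M].

(* Meaningful for f in Hoo, where the set below is bounded. *)
Definition norm_oo (R : realType) (n : nat) (f : 'rV[R[i]]_n -> R[i]) : R :=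
  sup [set cmod (f z) | z in @unit_ball R n].

Definition schur_class (R : realType) (n : nat) :
  set ('rV[R[i]]_n -> R[i]) := [set f | Hoo f /\ norm_oo f <= 1].

Definition interpolation_data (R : realType) (n m : nat)
    (z : 'I_m -> 'rV[R[i]]_n) (w : 'I_m -> R[i]) : Prop :=
  [/\ injective z, forall i, unit_ball (z i) & forall i, unit_disc (w i)].

Definition interpolates (R : realType) (n m : nat)
    (z : 'I_m -> 'rV[R[i]]_n) (w : 'I_m -> R[i])
    (f : 'rV[R[i]]_n -> R[i]) : Prop := forall i, f (z i) = w i.

Definition solves_extremal_problem (R : realType) (n m : nat)
    (z : 'I_m -> 'rV[R[i]]_n) (w : 'I_m -> R[i]) : Prop :=
  (exists f, schur_class f /\ interpolates z w f) /\
  (forall f, schur_class f -> interpolates z w f -> norm_oo f = 1).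

Definition extremal_functions (R : realType) (n : nat) :
    set ('rV[R[i]]_n -> R[i]) :=
  [set f | schur_class f /\
     exists (m : nat) (z : 'I_m -> 'rV[R[i]]_n) (w : 'I_m -> R[i]),
       [/\ interpolation_data z w, solves_extremal_problem z w
         & interpolates z w f]].

(* Main.v *)
Require Import Defs.
From mathcomp Require Import all_boot all_order all_algebra.
From mathcomp Require Import all_classical all_reals all_analysis.
From mathcomp Require Import complex.
From mathcomp Require Import ring lra.

Set Implicit Arguments.
Unset Strict Implicit.
Unset Printing Implicit Defensive.

Import Order.TTheory GRing.Theory Num.Theory numFieldNormedType.Exports.

Local Open Scope classical_set_scope.
Local Open Scope complex_scope.
Local Open Scope ring_scope.

(* Add a node y near one of the z_i and, among all functions of the Schur class
   interpolating the data, take phi maximizing |phi(y)|; by a Schwarz lemma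
   |phi(y)| < 1 if y is close enough.  If a function f of norm < 1 interpolated the
   data extended by phi(y) at y, then f + eta q and f - eta q, with q a polynomial
   vanishing at the z_i but not at y and eta small, would still be in the Schur
   class, and one of them would exceed |phi(y)| at y.

   The maximizer is an ultrafilter limit.  For the limit to be analytic, power
   series expansions at a point must hold on a polydisc independent of the function
   and with uniform bounds on the coefficients.  Without Cauchy's formula, this is
   obtained on complex lines: with f(x) = s_0 + ... + s_(k-1) x^(k-1) + x^k G_k(x)
   and |f| <= M on the disc of radius T, the maximum principle bounds
   G_(k+1) = (G_k - s_k) / x by 2 / T times the bound of G_k, hence
   |G_k| <= M (2 / T)^k.  The maximum principle itself only needs expansions of
   order 2: the average of |G|^2 + e |x|^2 over the four points a + i^j t exceeds the
   value at a for small t. *)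

Arguments Normc.normc : simpl never.

(** * The modulus as a real-valued norm on [R[i]] *)

Section Modulus.
Variable R : realType.
Implicit Types x y : R[i].

Lemma normcE_cmod x : `|x| = (cmod x)%:C.
Proof. by case: x => a b; rewrite normc_def. Qed.

Lemma cmod_ge0 x : 0 <= cmod x.
Proof. by rewrite -ler0c -normcE_cmod. Qed.

Lemma cmod_sqr x : cmod x ^+ 2 = complex.Re x ^+ 2 + complex.Im x ^+ 2.
Proof. by case: x => a b; rewrite /Normc.normc sqr_sqrtr// addr_ge0// sqr_ge0. Qed.

Lemma cmodR (r : R) : cmod r%:C = `|r|.
Proof. by rewrite /Normc.normc /= expr0n addr0 sqrtr_sqr. Qed.

Lemma cmod0 : cmod (0 : R[i]) = 0.
Proof. exact: Normc.normc0. Qed.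

Lemma cmod1 : cmod (1 : R[i]) = 1.
Proof. exact: Normc.normc1. Qed.

Lemma cmodM x y : cmod (x * y) = cmod x * cmod y.
Proof. exact: Normc.normcM. Qed.

Lemma cmodV x : cmod x^-1 = (cmod x)^-1.
Proof. exact: Normc.normcV. Qed.

Lemma cmodN x : cmod (- x) = cmod x.
Proof. exact: normcN. Qed.

Lemma cmodX x k : cmod (x ^+ k) = cmod x ^+ k.
Proof. by elim: k => [|k ih]; rewrite ?expr0 ?cmod1// !exprS cmodM ih. Qed.

Lemma cmodD x y : cmod (x + y) <= cmod x + cmod y.
Proof. exact: le_normcD. Qed.

Lemma cmodB x y : cmod (x - y) <= cmod x + cmod y.
Proof. by rewrite -(cmodN y) cmodD. Qed.

Lemma cmod_distC x y : cmod (x - y) = cmod (y - x).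
Proof. by rewrite -cmodN opprB. Qed.

Lemma cmod_distD z x y : cmod (x - y) <= cmod (x - z) + cmod (z - y).
Proof. by rewrite (le_trans _ (cmodD _ _))// subrKA. Qed.

Lemma cmod_eq0 x : (cmod x == 0) = (x == 0).
Proof.
by apply/eqP/eqP => [/Normc.eq0_normc//|->]; rewrite cmod0.
Qed.

Lemma cmod_gt0 x : (0 < cmod x) = (x != 0).
Proof. by rewrite lt_def cmod_ge0 andbT cmod_eq0. Qed.

Lemma cmod_sum (I : Type) (r : seq I) (P : pred I) (F : I -> R[i]) :
  cmod (\sum_(i <- r | P i) F i) <= \sum_(i <- r | P i) cmod (F i).
Proof.
elim/big_ind2 : _ => [|x u y v xu yv|//]; first by rewrite cmod0.
exact: le_trans (cmodD _ _) (lerD xu yv).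
Qed.

Lemma cmod_prod (I : Type) (r : seq I) (P : pred I) (F : I -> R[i]) :
  cmod (\prod_(i <- r | P i) F i) = \prod_(i <- r | P i) cmod (F i).
Proof. by elim/big_ind2 : _ => [|x u y v <- <-|//]; rewrite ?cmod1 ?cmodM. Qed.

Lemma cmod_nat (k : nat) : cmod (k%:R : R[i]) = k%:R.
Proof.
have -> : (k%:R : R[i]) = (k%:R : R)%:C by rewrite rmorph_nat.
by rewrite cmodR normr_nat.
Qed.

Lemma Re_le_cmod x : `|complex.Re x| <= cmod x.
Proof. by rewrite -lecR -normcE_cmod normc_ge_Re. Qed.

Lemma Im_le_cmod x : `|complex.Im x| <= cmod x.
Proof.
rewrite -(ler_pXn2r (n := 2))// ?nnegrE ?cmod_ge0// cmod_sqr.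
by rewrite real_normK ?num_real// lerDr sqr_ge0.
Qed.

Lemma cmod_le_ReIm x : cmod x <= `|complex.Re x| + `|complex.Im x|.
Proof.
rewrite -(ler_pXn2r (n := 2))// ?nnegrE ?cmod_ge0 ?addr_ge0// cmod_sqr.
rewrite sqrrD !real_normK ?num_real// lerD2r lerDl.
by rewrite mulrn_wge0 ?mulr_ge0.
Qed.

(** A positive element of [R[i]] is a positive real, so tolerances can be taken in [R]. *)
Lemma cvg_cmodP (u : nat -> R[i]) (l : R[i]) :
  ((u : nat -> R[i]^o) @ \oo --> (l : R[i]^o)) <->
  (forall e : R, 0 < e -> exists N, forall k, (N <= k)%N -> cmod (l - u k) <= e).
Proof.
split=> [/cvgrPdist_le cu e e0|cu].
  have e0C : 0 < e%:C by rewrite ltcR.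
  have [N _ HN] := cu _ e0C.
  exists N => k Nk; rewrite -lecR -normcE_cmod; exact: (HN k).
apply/cvgrPdist_le => e; rewrite ltcE /= => /andP[/eqP Ime Ree].
have [N HN] := cu _ Ree.
exists N => // k Nk; rewrite normcE_cmod.
by rewrite lecE /= -Ime eqxx (HN k).
Qed.

End Modulus.

(** * Limits and maximizers along ultrafilters *)

Section UltraLimits.
Variable R : realType.

Lemma ultra_meets (T : Type) (U : set_system T) (A B : set T) :
  UltraFilter U -> U A -> U B -> exists2 t, A t & B t.
Proof.
move=> UU UA UB; have UF : ProperFilter U := ultra_proper.
by have [t []] := filter_ex (filterI UA UB); exists t.
Qed.

(** The limit is the supremum of the [s] with [s <= x t] for [U]-most [t]. If [U] contained the set
    where [sup S + e <= x t], then [sup S + e] would lie in [S]; so [U] contains its complement. *)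
Lemma ultra_lim_real (T : Type) (U : set_system T) (x : T -> R) (B : R) :
  UltraFilter U -> U [set t | `|x t| <= B] ->
  exists l, forall e, 0 < e -> U [set t | `|x t - l| <= e].
Proof.
move=> UU UB.
pose S := [set s | U [set t | s <= x t]].
have SB : S (- B) by apply: filterS UB => t /=; rewrite ler_norml => /andP[].
have Sub : ubound S B.
  move=> s Ss; have [t /= + st] := ultra_meets UU UB Ss.
  by rewrite ler_norml => /andP[_]; exact: le_trans.
have hS : has_sup S by split; [exists (- B)|exists B].
exists (sup S) => e e0.
have [s Ss les] := sup_adherent e0 hS.
have Ult : U [set t | x t < sup S + e].
  have [|] := in_ultra_setVsetC [set t | sup S + e <= x t] UU.
    by move/(ub_le_sup (proj2 hS)); rewrite gerDl leNgt e0.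
  by apply: filterS => t /= /negP; rewrite -ltNge.
apply: filterS (filterI Ss Ult) => t /= [st tlt].
by rewrite ler_norml; apply/andP; split; lra.
Qed.

Lemma ultra_lim (T : Type) (U : set_system T) (x : T -> R[i]) (B : R) :
  UltraFilter U -> U [set t | cmod (x t) <= B] ->
  exists l, forall e, 0 < e -> U [set t | cmod (x t - l) <= e].
Proof.
move=> UU UB.
have [|a Ha] := @ultra_lim_real _ U (fun t => complex.Re (x t)) B UU.
  by apply: filterS UB => t /= /(le_trans (Re_le_cmod _)).
have [|b Hb] := @ultra_lim_real _ U (fun t => complex.Im (x t)) B UU.
  by apply: filterS UB => t /= /(le_trans (Im_le_cmod _)).
exists (a +i* b) => e e0; have e20 : 0 < e / 2 by lra.
apply: filterS (filterI (Ha _ e20) (Hb _ e20)) => t /= [ta tb].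
rewrite (le_trans (cmod_le_ReIm _))//.
case: (x t) ta tb => u v /= ta tb; lra.
Qed.

Lemma ultra_lim_le (T : Type) (U : set_system T) (x : T -> R[i]) (l y : R[i])
    (B : R) :
  UltraFilter U -> (forall e, 0 < e -> U [set t | cmod (x t - l) <= e]) ->
  U [set t | cmod (x t - y) <= B] -> cmod (l - y) <= B.
Proof.
move=> UU Ul UB; apply/ler_addgt0Pr => e e0.
have [t /= tl tB] := ultra_meets UU (Ul _ e0) UB.
by rewrite (le_trans (cmod_distD (x t) _ _))// addrC lerD// cmod_distC.
Qed.

(** The superlevel sets of [H] at points of [D] are nested, hence a filter base; a finer ultrafilter
    plays the role of a maximizing sequence. *)
Lemma maximizing_ultra (T : Type) (D : set T) (H : T -> R) :
  D !=set0 -> exists U : set_system T,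
    [/\ UltraFilter U, U D & forall a, D a -> U [set z | H a <= H z]].
Proof.
move=> [a0 Da0].
pose F := filter_from D (fun a => [set z | D z /\ H a <= H z]).
have FF : ProperFilter F.
  apply: filter_from_proper; last by move=> a Da; exists a.
  apply: filter_from_filter; first by exists a0.
  move=> a b Da Db; have [ab|/ltW ba] := leP (H a) (H b).
    by exists b => // z [Dz bz]; do 2?split => //; exact: le_trans bz.
  by exists a => // z [Dz az]; do 2?split => //; exact: le_trans az.
have [U [UU FU]] := ultraFilterLemma FF.
exists U; split => //; first by apply: FU; exists a0 => // z [].
by move=> a Da; apply: FU; exists a => // z [].
Qed.

(** The second hypothesis is upper semicontinuity. A maximizing ultrafilter on the disc has a limit
    in the disc, and semicontinuity makes this limit a maximum point. *)
Lemma usc_max_on_disc (H : R[i] -> R) (T : R) : 0 <= T ->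
  (forall a, cmod a <= T -> forall e, 0 < e -> exists2 d, 0 < d &
    forall z, cmod z <= T -> cmod (z - a) <= d -> H z <= H a + e) ->
  exists2 a, cmod a <= T & forall z, cmod z <= T -> H z <= H a.
Proof.
move=> T0 usc.
have [|U [UU UD UH]] := @maximizing_ultra _ [set z | cmod z <= T] H.
  by exists 0 => /=; rewrite cmod0.
have [l Hl] := @ultra_lim _ U id T UU UD.
have lT : cmod l <= T.
  rewrite -[l]subr0; apply: (ultra_lim_le UU Hl).
  by apply: filterS UD => z; rewrite /= subr0.
exists l => // z zT; apply/ler_addgt0Pr => e e0.
have [d d0 Hd] := usc _ lT _ e0.
have [t /= [tD tH] tl] := ultra_meets UU (filterI UD (UH _ zT)) (Hl _ d0).
exact: le_trans tH (Hd _ tD tl).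
Qed.

End UltraLimits.

(** * Local polynomial expansions in one variable, and the maximum principle *)

Section Jets.
Variable R : realType.
Implicit Types (g f : R[i] -> R[i]) (a h : R[i]) (p q : {poly R[i]}).

(** An expansion of order [k] at [a]. The degree of [p] is left free so that products need no
    truncation, and [d <= 1] lets higher powers of [cmod h] be bounded by lower ones. *)
Definition jet g a (k : nat) := exists p (K d : R), [/\ 0 <= K, 0 < d, d <= 1 &
  forall h, cmod h <= d -> cmod (g (a + h) - p.[h]) <= K * cmod h ^+ k].

Lemma jetP g a k p (K d : R) : 0 < d ->
  (forall h, cmod h <= d -> cmod (g (a + h) - p.[h]) <= K * cmod h ^+ k) ->
  jet g a k.
Proof.
move=> d0 H; exists p, `|K|, (Num.min d 1); split => //.
- by rewrite lt_min d0 ltr01.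
- by rewrite ge_min lexx orbT.
- move=> h; rewrite le_min => /andP[/H hd _]; apply: (le_trans hd).
  by rewrite ler_wpM2r ?exprn_ge0 ?cmod_ge0// ler_norm.
Qed.

Lemma horner_bounded p : exists2 B : R, 0 <= B &
  forall h, cmod h <= 1 -> cmod p.[h] <= B.
Proof.
exists (\sum_(i < size p) cmod p`_i); first by apply: sumr_ge0 => i _; exact: cmod_ge0.
move=> h h1; rewrite horner_coef (le_trans (cmod_sum _ _ _))//.
apply: ler_sum => i _; rewrite cmodM cmodX ler_piMr ?cmod_ge0//.
by rewrite exprn_ile1// cmod_ge0.
Qed.

Lemma jet_horner p a k : jet (horner p) a k.
Proof.
apply: (@jetP _ _ _ (p \Po ('X + a%:P)) 0 1) => // h _.
by rewrite horner_comp !hornerE (addrC h) subrr cmod0.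
Qed.

Lemma jetB g f a k : jet g a k -> jet f a k -> jet (fun z => g z - f z) a k.
Proof.
move=> [p [K [d [K0 d0 _ Hp]]]] [q [L [e [L0 e0 _ Hq]]]].
apply: (@jetP _ _ _ (p - q) (K + L) (Num.min d e)).
  by rewrite lt_min d0.
move=> h; rewrite le_min => /andP[/Hp hp /Hq hq].
rewrite hornerD hornerN mulrDl (le_trans _ (lerD hp hq))//.
rewrite (le_trans _ (cmodB _ _))//.
by rewrite (_ : _ - _ = g (a + h) - p.[h] - (f (a + h) - q.[h]))//; ring.
Qed.

Lemma jetM g f a k : jet g a k -> jet f a k -> jet (fun z => g z * f z) a k.
Proof.
move=> [p [K [d [K0 d0 d1 Hp]]]] [q [L [e [L0 e0 e1 Hq]]]].
have [P P0 HP] := horner_bounded p; have [Q Q0 HQ] := horner_bounded q.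
apply: (@jetP _ _ _ (p * q) (K * (Q + L) + P * L) (Num.min d e)).
  by rewrite lt_min d0.
move=> h; rewrite le_min => /andP[hd he].
have h1 : cmod h <= 1 by exact: le_trans d1.
have -> : g (a + h) * f (a + h) - (p * q).[h] =
    (g (a + h) - p.[h]) * f (a + h) + p.[h] * (f (a + h) - q.[h]).
  by rewrite hornerM; ring.
rewrite (le_trans (cmodD _ _))// !cmodM mulrDl lerD//; last first.
  by rewrite -mulrA ler_pM ?cmod_ge0// ?HP// Hq.
rewrite mulrAC ler_pM ?cmod_ge0// ?Hp//.
rewrite -[f _](subrK q.[h]) (le_trans (cmodD _ _))// addrC lerD ?HQ//.
rewrite (le_trans (Hq _ he))// ler_piMr// exprn_ile1// cmod_ge0//.
Qed.

(** Truncating the geometric series leaves exactly [- h ^+ 3 / (a ^+ 3 * (a + h))], and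
    [cmod (a + h)] is at least half of [cmod a]. *)
Lemma jetV a : a != 0 -> jet (fun z => z^-1) a 3.
Proof.
move=> a0; have ca0 : 0 < cmod a by rewrite cmod_gt0.
apply: (@jetP _ _ _ (a^-1%:P - (a ^- 2)%:P * 'X + (a ^- 3)%:P * 'X^2)
  (2 / cmod a ^+ 4) (cmod a / 2)); first by rewrite divr_gt0.
move=> h ha.
have lah : cmod a / 2 <= cmod (a + h).
  by have := cmodB (a + h) h; rewrite addrK => ?; lra.
have ah0 : a + h != 0 by rewrite -cmod_gt0 (lt_le_trans _ lah)// divr_gt0.
set p := (X in X.[h]).
have -> : (a + h)^-1 - p.[h] = - (h ^+ 3 * (a ^- 3 * (a + h)^-1)).
  rewrite /p !hornerE /=.
  by field; rewrite a0 ah0.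
rewrite cmodN !cmodM !cmodV !cmodX [leLHS]mulrC ler_wpM2r ?exprn_ge0 ?mulr_ge0 ?cmod_ge0//.
have -> : 2 / cmod a ^+ 4 = (cmod a ^+ 3)^-1 * (cmod a / 2)^-1.
  by field; rewrite gt_eqF.
rewrite ler_wpM2l ?invr_ge0 ?exprn_ge0 ?cmod_ge0// lef_pV2// posrE ?divr_gt0//.
by rewrite (lt_le_trans _ lah)// divr_gt0.
Qed.

Lemma jet_near g f a k (d : R) : 0 < d ->
  (forall h, cmod h <= d -> f (a + h) = g (a + h)) -> jet g a k -> jet f a k.
Proof.
move=> d0 fg [p [K [e [K0 e0 _ Hp]]]].
apply: (@jetP _ _ _ p K (Num.min d e)); first by rewrite lt_min d0.
by move=> h; rewrite le_min => /andP[/fg -> /Hp].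
Qed.

(** Evaluation at [h = 0] identifies the constant coefficient of [p] with [g a]; the part of [p] of
    degree at least 3 goes into the error term. *)
Lemma jet3P g a : jet g a 3 -> exists b c (K d : R), [/\ 0 <= K, 0 < d, d <= 1 &
  forall h, cmod h <= d ->
    cmod (g (a + h) - (g a + b * h + c * h ^+ 2)) <= K * cmod h ^+ 3].
Proof.
move=> [p [K [d [K0 d0 d1 Hp]]]].
have ga : g a = p`_0.
  have := Hp 0; rewrite cmod0 addr0 horner_coef0 expr0n mulr0 => /(_ (ltW d0)).
  by rewrite le_eqVlt ltNge cmod_ge0 orbF cmod_eq0 subr_eq0 => /eqP.
have [Q Q0 HQ] := horner_bounded (drop_poly 3 p).
exists p`_1, p`_2, (K + Q), d; split; rewrite ?addr_ge0// => h hd.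
have ph : p.[h] = g a + p`_1 * h + p`_2 * h ^+ 2 + (drop_poly 3 p).[h] * h ^+ 3.
  rewrite -{1}(poly_take_drop 3 p) hornerD hornerM hornerXn; congr (_ + _).
  by rewrite /take_poly horner_poly !big_ord_recr big_ord0 /= add0r expr0 expr1 mulr1 ga.
have -> : g (a + h) - (g a + p`_1 * h + p`_2 * h ^+ 2) =
    (g (a + h) - p.[h]) + (drop_poly 3 p).[h] * h ^+ 3 by rewrite ph; ring.
rewrite (le_trans (cmodD _ _))// mulrDl lerD ?Hp// cmodM cmodX.
by rewrite ler_wpM2r ?exprn_ge0 ?cmod_ge0// HQ// (le_trans hd).
Qed.

Lemma jet3_lipschitz g a : jet g a 3 -> exists (K d : R), [/\ 0 <= K, 0 < d, d <= 1 &
  forall h, cmod h <= d -> cmod (g (a + h) - g a) <= K * cmod h].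
Proof.
move=> /jet3P[b [c [K [d [K0 d0 d1 Hd]]]]].
exists (K + cmod b + cmod c), d; split; rewrite ?addr_ge0 ?cmod_ge0// => h hd.
have h1 : cmod h <= 1 by exact: le_trans d1.
have -> : g (a + h) - g a = (g (a + h) - (g a + b * h + c * h ^+ 2)) +
  b * h + c * h ^+ 2 by ring.
rewrite !mulrDl (le_trans (cmodD _ _))// lerD//; last first.
  by rewrite cmodM ler_wpM2l ?cmod_ge0// cmodX expr2 ler_piMr ?cmod_ge0.
rewrite (le_trans (cmodD _ _))// lerD ?cmodM//.
rewrite (le_trans (Hd _ hd))// ler_wpM2l// exprS ler_piMr ?cmod_ge0//.
by rewrite exprn_ile1// cmod_ge0.
Qed.

(* Averaging over the four points i^j t kills all the cross terms. *)
Lemma four_point_average (x b c : R[i]) (t : R) :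
  let q h := x + b * h + c * h ^+ 2 in
  cmod (q t%:C) ^+ 2 + cmod (q (- t%:C)) ^+ 2 + cmod (q (t *i)) ^+ 2
    + cmod (q (- (t *i))) ^+ 2
  = 4 * (cmod x ^+ 2 + cmod b ^+ 2 * t ^+ 2 + cmod c ^+ 2 * t ^+ 4).
Proof.
case: x b c => [x1 x2] [b1 b2] [c1 c2].
rewrite /= !cmod_sqr !expr2 /=; ring.
Qed.

Lemma four_point_average_norm a (t : R) :
  cmod (a + t%:C) ^+ 2 + cmod (a - t%:C) ^+ 2 + cmod (a + t *i) ^+ 2
    + cmod (a - t *i) ^+ 2 = 4 * (cmod a ^+ 2 + t ^+ 2).
Proof. by case: a => a1 a2; rewrite !cmod_sqr !expr2 /=; ring. Qed.

Lemma sqr_perturb (x y e : R) : 0 <= x -> 0 <= y -> 0 <= e -> y - e <= x ->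
  y ^+ 2 - 2 * y * e <= x ^+ 2.
Proof.
move=> x0 y0 e0 yex; have [ey|ye] := leP e y; last nra.
have : (y - e) ^+ 2 <= x ^+ 2 by rewrite ler_pXn2r// nnegrE subr_ge0.
nra.
Qed.

(** On average over the four points at distance [t], the quadratic part [q] and the weight [e] gain
    at least [e * t ^+ 2], while replacing [g] by [q] costs at most [2 * Q * K * t ^+ 3], which is
    smaller by the choice of [t]. *)
Lemma no_interior_max g a (e d : R) : 0 < e -> 0 < d -> jet g a 3 ->
  ~ (forall h, cmod h <= d -> cmod (g (a + h)) ^+ 2 + e * cmod (a + h) ^+ 2
      <= cmod (g a) ^+ 2 + e * cmod a ^+ 2).
Proof.
move=> e0 d0 /jet3P[b [c [K [r [K0 r0 r1 Hr]]]]] Hmax.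
pose Q := cmod (g a) + cmod b + cmod c.
have Q0 : 0 <= Q by rewrite !addr_ge0 ?cmod_ge0.
pose t := Num.min (Num.min d r) (e / (2 * Q * K + 1) / 2).
have QK0 : 0 <= Q * K by rewrite mulr_ge0.
have den0 : 0 < 2 * Q * K + 1 by rewrite -mulrA; lra.
have t0 : 0 < t by rewrite !lt_min d0 r0/= !divr_gt0.
have td : t <= d by rewrite /t !ge_min lexx.
have tr : t <= r by rewrite /t !ge_min lexx orbT.
have t1 : t <= 1 by exact: le_trans r1.
have tQ : (2 * Q * K) * t < e.
  have : t * (2 * (2 * Q * K + 1)) <= e.
    rewrite -ler_pdivlMr ?mulr_gt0// invfM mulrA.
    by rewrite /t !ge_min mulrAC lexx orbT.
  by nra.
pose q h := g a + b * h + c * h ^+ 2.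
have point h : cmod h = t -> cmod (q h) ^+ 2 + e * cmod (a + h) ^+ 2 <=
    cmod (g a) ^+ 2 + e * cmod a ^+ 2 + 2 * Q * K * t ^+ 3.
  move=> ht; have hd : cmod h <= d by rewrite ht.
  have hr : cmod h <= r by rewrite ht.
  have qQ : cmod (q h) <= Q.
    rewrite (le_trans (cmodD _ _))// lerD//.
      rewrite (le_trans (cmodD _ _))// lerD// cmodM ht.
      by rewrite ler_piMr ?cmod_ge0.
    by rewrite cmodM cmodX ht ler_piMr ?cmod_ge0// exprn_ile1// ltW.
  have err := Hr _ hr; rewrite -/(q h) ht in err.
  have Kt0 : 0 <= K * t ^+ 3 by rewrite mulr_ge0// exprn_ge0// ltW.
  have lower : cmod (q h) - K * t ^+ 3 <= cmod (g (a + h)).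
    rewrite lerBlDr -lerBlDl (le_trans _ err)// cmod_distC lerBlDl.
    by rewrite (le_trans _ (cmodD _ _))// addrC subrK.
  have := sqr_perturb (cmod_ge0 _) (cmod_ge0 _) Kt0 lower.
  have := Hmax _ hd.
  have : cmod (q h) * (K * t ^+ 3) <= Q * (K * t ^+ 3) by rewrite ler_wpM2r.
  by lra.
have ct : cmod t%:C = t by rewrite cmodR gtr0_norm.
have cit : cmod (t *i) = t.
  by rewrite /Normc.normc expr0n add0r sqrtr_sqr gtr0_norm.
have E1 := four_point_average_norm a t.
have E2 : cmod (q t%:C) ^+ 2 + cmod (q (- t%:C)) ^+ 2 + cmod (q (t *i)) ^+ 2
    + cmod (q (- (t *i))) ^+ 2
  = 4 * (cmod (g a) ^+ 2 + cmod b ^+ 2 * t ^+ 2 + cmod c ^+ 2 * t ^+ 4).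
  exact: four_point_average.
have := point t%:C ct; have := point (t *i) cit.
have := point (- t%:C); rewrite cmodN => /(_ ct).
have := point (- (t *i)); rewrite cmodN => /(_ cit).
have b0 : 0 <= cmod b ^+ 2 * t ^+ 2 by rewrite mulr_ge0// sqr_ge0.
have c0 : 0 <= cmod c ^+ 2 * t ^+ 4 by rewrite mulr_ge0// ?sqr_ge0 ?exprn_ge0// ltW.
move=> p1 p2 p3 p4.
have : e * (4 * (cmod a ^+ 2 + t ^+ 2)) <=
    4 * (e * cmod a ^+ 2) + 4 * (2 * Q * K * t ^+ 3).
  rewrite -E1 !(mulrDr e); clearbody q Q t.
  lra.
rewrite leNgt => /negP; apply.
have t2 : 0 < t ^+ 2 by rewrite exprn_gt0.
have : (2 * Q * K * t) * t ^+ 2 < e * t ^+ 2 by rewrite ltr_pM2r.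
by rewrite exprS; lra.
Qed.

(** If [B < cmod (g a)], the function [cmod (g z) ^+ 2 + e * cmod z ^+ 2] attains a maximum on the
    disc: for small [e] it cannot lie on the circle, and [no_interior_max] excludes the interior. *)
Lemma max_principle g (T B : R) : 0 <= B ->
  (forall a, cmod a <= T -> jet g a 3) ->
  (forall a, cmod a = T -> cmod (g a) <= B) ->
  forall a, cmod a <= T -> cmod (g a) <= B.
Proof.
move=> B0 gjet gB a aT; rewrite leNgt; apply/negP => Bga.
have T0 : 0 <= T := le_trans (cmod_ge0 _) aT.
(* This keeps [e * T ^+ 2] below the gap [cmod (g a) ^+ 2 - B ^+ 2]. *)
pose e := (cmod (g a) ^+ 2 - B ^+ 2) / (T ^+ 2 + 1) / 2.
have T21 : 0 < T ^+ 2 + 1 by rewrite ltr_wpDl ?sqr_ge0.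
have dif0 : 0 < cmod (g a) ^+ 2 - B ^+ 2.
  by rewrite subr_gt0 ltr_pXn2r// nnegrE cmod_ge0.
have e0 : 0 < e by rewrite !divr_gt0.
pose H z := cmod (g z) ^+ 2 + e * cmod z ^+ 2.
have [z zT|z zT zmax] := usc_max_on_disc (H := H) T0.
  move=> eta eta0.
  have [K [d [K0 d0 d1 Hd]]] := jet3_lipschitz (gjet _ zT).
  (* Within distance [d <= 1] of [z], the increase of [H] is at most [L] times the distance. *)
  pose L := 2 * K * cmod (g z) + K ^+ 2 + e * (2 * cmod z + 1).
  have L0 : 0 <= L.
    have ? := cmod_ge0 (g z); have ? := cmod_ge0 z.
    by rewrite /L; apply: addr_ge0; [nra|apply: mulr_ge0; lra].
  exists (Num.min d (eta / (L + 1))).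
    by rewrite lt_min d0 divr_gt0// ltr_wpDl.
  move=> w _; rewrite le_min => /andP[wd wL].
  have {}wL : cmod (w - z) * L <= eta.
    move: wL; rewrite ler_pdivlMr ?ltr_wpDl//; apply: le_trans.
    by rewrite ler_wpM2l ?cmod_ge0// lerDl.
  move: (Hd _ wd); rewrite (addrC z) subrK => gw.
  rewrite /H; have x0 := cmod_ge0 (w - z); set x := cmod (w - z) in wd wL gw x0.
  have x1 : x <= 1 by exact: le_trans d1.
  have wz : cmod w <= cmod z + x.
    by rewrite -{1}[w](subrK z) (le_trans (cmodD _ _))// addrC.
  have gwz : cmod (g w) <= cmod (g z) + K * x.
    by rewrite -{1}[g w](subrK (g z)) (le_trans (cmodD _ _))// addrC lerD2l.
  have x2 : x ^+ 2 <= x by rewrite expr2 ler_piMr.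
  have sqw : cmod w ^+ 2 <= cmod z ^+ 2 + (2 * cmod z + 1) * x.
    have : cmod w ^+ 2 <= (cmod z + x) ^+ 2.
      by rewrite ler_pXn2r// nnegrE ?addr_ge0 ?cmod_ge0.
    by lra.
  have sqg : cmod (g w) ^+ 2 <= cmod (g z) ^+ 2 + (2 * K * cmod (g z) + K ^+ 2) * x.
    have : cmod (g w) ^+ 2 <= (cmod (g z) + K * x) ^+ 2.
      by rewrite ler_pXn2r// nnegrE ?addr_ge0 ?mulr_ge0 ?cmod_ge0.
    have : K ^+ 2 * x ^+ 2 <= K ^+ 2 * x by rewrite ler_wpM2l ?sqr_ge0.
    by lra.
  have : e * cmod w ^+ 2 <= e * (cmod z ^+ 2 + (2 * cmod z + 1) * x).
    by rewrite ler_pM2l.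
  by move: wL; rewrite /L; lra.
have za := zmax _ aT; rewrite /H in za.
have eT : e * T ^+ 2 < cmod (g a) ^+ 2 - B ^+ 2.
  have : 2 * (e * T ^+ 2) + 2 * e = cmod (g a) ^+ 2 - B ^+ 2.
    by rewrite /e; field; rewrite gt_eqF.
  have : 0 <= e * T ^+ 2 by rewrite mulr_ge0 ?sqr_ge0// ltW.
  by move: e0; clearbody e; lra.
have [zeT|zltT] := eqVneq (cmod z) T.
  have gz2 : cmod (g z) ^+ 2 <= B ^+ 2.
    by rewrite ler_pXn2r// ?nnegrE ?cmod_ge0// gB.
  have ea0 : 0 <= e * cmod a ^+ 2 by rewrite mulr_ge0 ?sqr_ge0// ltW.
  by move: za; rewrite zeT; lra.
have zT' : 0 < T - cmod z by rewrite subr_gt0 lt_neqAle zltT.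
apply: (no_interior_max e0 zT' (gjet _ zT)) => h hz.
apply: zmax; rewrite (le_trans (cmodD _ _))//; lra.
Qed.

End Jets.

(** * Repeated division by the variable: bounds on Taylor coefficients and remainders *)

Section SchwarzDivision.
Variable R : realType.
Variables (F : R[i] -> R[i]) (s : nat -> R[i]) (T M : R).
Hypothesis T0 : 0 < T.
Hypothesis F_bounded : forall a, cmod a <= T -> cmod (F a) <= M.
Hypothesis F_jet : forall a, cmod a <= T -> jet F a 3.
Hypothesis F_expansion : forall k, exists K d : R, 0 < d /\ forall h, cmod h <= d ->
  cmod (F h - \sum_(j < k) s j * h ^+ j) <= K * cmod h ^+ k.

(** The remainder of order [k] divided by [a ^+ k], with its limit [s k] filled in at 0. *)
Let G k a := if a == 0 then s k else (F a - \sum_(j < k) s j * a ^+ j) * a^-1 ^+ k.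

Let G_jet k a : cmod a <= T -> jet (G k) a 3.
Proof.
move=> aT; have [->|a0] := eqVneq a 0.
  (* Order [k + 3] leaves an error of order 3 after the division by [h ^+ k]. *)
  have [K [d [d0 Hd]]] := F_expansion (k + 3).
  apply: (@jetP _ _ _ _ ((s k)%:P + (s k.+1)%:P * 'X + (s k.+2)%:P * 'X^2) K d d0).
  move=> h /Hd; rewrite add0r /G addn3 !big_ord_recr /=.
  set S := \sum_(_ < _) _.
  have -> : ((s k)%:P + (s k.+1)%:P * 'X + (s k.+2)%:P * 'X^2).[h] =
      s k + s k.+1 * h + s k.+2 * h ^+ 2 by rewrite !hornerE.
  have [->|h0] := eqVneq h 0.
    by move=> _; rewrite !expr0n /= !mulr0 !addr0 subrr cmod0 expr0n mulr0.
  have -> : (F h - S) * h^-1 ^+ k - (s k + s k.+1 * h + s k.+2 * h ^+ 2) =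
     (F h - (S + s k * h ^+ k + s k.+1 * h ^+ k.+1 + s k.+2 * h ^+ k.+2)) * h^-1 ^+ k.
    by rewrite !exprS exprVn; field; rewrite expf_neq0.
  rewrite cmodM cmodX cmodV => H.
  have h0' : 0 < cmod h by rewrite cmod_gt0.
  rewrite exprVn ler_pdivrMr ?exprn_gt0// (le_trans H)// -mulrA -exprD.
  by rewrite addnC addn3.
have ca0 : 0 < cmod a by rewrite cmod_gt0.
apply: (@jet_near _ (fun z => (F z - (\poly_(j < k) s j).[z]) * z^-1 ^+ k)
  _ _ _ (cmod a / 2)).
- by rewrite divr_gt0.
- move=> h ha; have ah0 : a + h != 0.
    rewrite -cmod_gt0; have := cmodB (a + h) h; rewrite addrK; lra.
  by rewrite /G (negbTE ah0) horner_poly.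
- apply: jetM; first by apply: jetB; [exact: F_jet|exact: jet_horner].
  elim: k => [|k ih].
    apply: (@jet_near _ (horner 1) _ _ _ 1) => //; last exact: jet_horner.
    by move=> h _; rewrite expr0 hornerC.
  apply: (@jet_near _ (fun z => z^-1 * z^-1 ^+ k) _ _ _ 1) => //.
    by move=> h _; rewrite exprS.
  exact: jetM (jetV a0) ih.
Qed.

Let G_bounded k a : cmod a <= T -> cmod (G k a) <= M * (2 / T) ^+ k.
Proof.
have M0 : 0 <= M.
  by apply: le_trans (F_bounded (a := 0) _); rewrite ?cmod_ge0 ?cmod0 ?ltW.
elim: k a => [|k ih] a aT.
  rewrite expr0 mulr1 /G; case: eqP => [_|_]; last first.
    by rewrite big_ord0 subr0 expr0 mulr1 F_bounded.
  (* The expansion of order 1, evaluated at [h = 0], gives [F 0 = s 0]. *)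
  have [K [d [d0 Hd]]] := F_expansion 1.
  have := Hd 0; rewrite cmod0 big_ord_recl big_ord0 !expr0 mulr1 addr0 mulr0 => /(_ (ltW d0)).
  rewrite le_eqVlt ltNge cmod_ge0 orbF cmod_eq0 subr_eq0 => /eqP <-.
  by rewrite F_bounded// cmod0 ltW.
move: a aT; apply: max_principle; last 1 first.
- move=> a aT; have a0 : a != 0 by rewrite -cmod_gt0 aT.
  have -> : G k.+1 a = (G k a - G k 0) * a^-1.
    rewrite /G eqxx (negbTE a0) big_ord_recr /= exprS !exprVn; field.
    by rewrite a0 expf_neq0.
  rewrite cmodM cmodV aT exprS mulrCA mulrAC ler_wpM2r ?invr_ge0 ?(ltW T0)//.
  rewrite (le_trans (cmodB _ _))// [leRHS]mulr_natl mulr2n lerD// ih ?aT//.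
  by rewrite cmod0 ltW.
- by rewrite mulr_ge0// exprn_ge0// divr_ge0// ltW.
- by move=> a aT; exact: G_jet.
Qed.

Lemma schwarz_coefficient k : cmod (s k) <= M * (2 / T) ^+ k.
Proof. by have := G_bounded k (a := 0); rewrite /G eqxx cmod0; apply; exact: ltW. Qed.

Lemma schwarz_remainder k a : cmod a <= T ->
  cmod (F a - \sum_(j < k) s j * a ^+ j) <= M * (2 / T) ^+ k * cmod a ^+ k.
Proof.
move=> aT; have [->|a0] := eqVneq a 0.
  have [K [d [d0 Hd]]] := F_expansion k.
  case: k Hd => [_|k Hd].
    by rewrite big_ord0 subr0 !expr0 !mulr1 F_bounded// cmod0 ltW.
  by have := Hd 0; rewrite cmod0 expr0n !mulr0; apply; exact: ltW.
have := G_bounded k aT; rewrite /G (negbTE a0) cmodM cmodX cmodV exprVn.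
by rewrite ler_pdivrMr// exprn_gt0// cmod_gt0.
Qed.

End SchwarzDivision.

(** * Multi-indices and the cubes that order the partial sums *)

Section MultiIndices.
Variable n : nat.
Local Notation mi := {ffun 'I_n -> nat}.

Definition deg (a : mi) : nat := (\sum_i a i)%N.

(** The range of the partial sums in [power_series_sums_to], as a sequence in a type independent of
    [N], so that cubes of different sizes can be compared. *)
Definition cube (N : nat) : seq mi :=
  [seq multi_index_of b | b <- index_enum {ffun 'I_n -> 'I_N}].

Lemma mem_cube N a : (a \in cube N) = [forall i, (a i < N)%N].
Proof.
apply/mapP/forallP => [[b _ ->] i|aN]; first by rewrite ffunE.
exists [ffun i => Ordinal (aN i)]; first by rewrite mem_index_enum.
by apply/ffunP => i; rewrite !ffunE.
Qed.

Lemma cube_uniq N : uniq (cube N).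
Proof.
rewrite map_inj_uniq ?index_enum_uniq// => b b' /ffunP bb'.
by apply/ffunP => i; apply: val_inj; have := bb' i; rewrite !ffunE.
Qed.

Lemma big_cube (V : nmodType) N (F : mi -> V) :
  \sum_(b : {ffun 'I_n -> 'I_N}) F (multi_index_of b) = \sum_(a <- cube N) F a.
Proof. by rewrite big_map. Qed.

Lemma leq_deg (a : mi) i : (a i <= deg a)%N.
Proof. by rewrite /deg (bigD1 i)//= leq_addr. Qed.

Lemma deg_cube (a : mi) N : (deg a < N)%N -> a \in cube N.
Proof.
move=> aN; rewrite mem_cube; apply/forallP => i.
exact: leq_ltn_trans (leq_deg a i) aN.
Qed.

(** A coordinate never exceeds the degree, so both cubes contain every index satisfying [P]. *)
Lemma big_cube_deg (V : nmodType) N k (P : pred mi) (F : mi -> V) : (k <= N)%N ->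
  (forall a, P a -> (deg a < k)%N) ->
  \sum_(a <- cube N | P a) F a = \sum_(a <- cube k | P a) F a.
Proof.
move=> kN Pk; rewrite -big_filter -[RHS]big_filter; apply: perm_big.
apply: uniq_perm; rewrite ?filter_uniq ?cube_uniq// => a.
rewrite !mem_filter; apply: andb_id2l => /Pk ak.
by rewrite !deg_cube// (leq_trans ak).
Qed.

Lemma sum_cube_le_mono (R : numDomainType) (F : mi -> R) N k : (k <= N)%N ->
  (forall a, 0 <= F a) -> \sum_(a <- cube k) F a <= \sum_(a <- cube N) F a.
Proof.
move=> kN F0; rewrite [leRHS](bigID (mem (cube k)))/= -[leLHS]addr0 lerD//; last first.
  by rewrite sumr_ge0.
rewrite le_eqVlt (_ : \sum_(a <- cube k) F a = \sum_(a <- cube N | a \in cube k) F a) ?eqxx//.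
rewrite -[RHS]big_filter; apply: perm_big.
apply: uniq_perm; rewrite ?filter_uniq ?cube_uniq// => a.
rewrite mem_filter; case: (boolP (a \in cube k)) => //=.
rewrite !mem_cube => /forallP ak; apply/esym/forallP => i.
exact: leq_trans kN.
Qed.

(** The sum over a cube is a product of [n] finite geometric sums, one for each coordinate. *)
Lemma sum_cube_geometric (R : numFieldType) (t : R) N : 0 <= t -> t < 1 ->
  \sum_(a <- cube N) t ^+ deg a <= (1 - t)^-1 ^+ n.
Proof.
move=> t0 t1; rewrite -big_cube.
have -> : \sum_(b : {ffun 'I_n -> 'I_N}) t ^+ deg (multi_index_of b) =
    \prod_(i < n) \sum_(j < N) t ^+ j.
  rewrite bigA_distr_bigA; apply: eq_bigr => b _.
  by rewrite -prodrXr; apply: eq_bigr => i _; rewrite ffunE.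
rewrite prodr_const card_ord.
have t1' : 0 < 1 - t by rewrite subr_gt0.
have [n0|n0] := posnP n; first by rewrite n0 !expr0.
rewrite ler_pXn2r// ?nnegrE ?sumr_ge0// ?invr_ge0 ?(ltW t1')// => [|i _]; last first.
  exact: exprn_ge0.
rewrite -[_^-1]mul1r ler_pdivlMr// mulrC.
by rewrite -opprB mulNr -subrX1 opprB gerBl exprn_ge0.
Qed.

End MultiIndices.

(** * Summability over multi-indices as boundedness over cubes *)

Section SummableCubes.
Variables (R : realType) (n : nat).

(** Cubes are finite, and every finite set of multi-indices lies in a cube. *)
Lemma summable_cubesP (F : {ffun 'I_n -> nat} -> R) : (forall a, 0 <= F a) ->
  (summable [set: {ffun 'I_n -> nat}] (fun a => (F a)%:E) <->
   exists B, forall N, \sum_(a <- cube n N) F a <= B).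
Proof.
move=> F0; have absF a : (`|(F a)%:E| = (F a)%:E)%E by rewrite abse_EFin ger0_norm.
split=> [sF|[B HB]].
  set S := \esum_(a in [set: {ffun 'I_n -> nat}]) `|(F a)%:E|%E.
  have /fineK E : S \is a fin_num by rewrite -summableE.
  exists (fine S) => N.
  rewrite -lee_fin E; apply: ereal_sup_ubound.
  exists [set` cube n N] => //=; first by split => //; exact: finite_seq.
  rewrite -fsbig_seq ?cube_uniq// -sumEFin.
  by apply: eq_bigr => a _; rewrite ger0_norm.
apply: (@le_lt_trans _ _ B%:E); last exact: ltry.
apply: ge_ereal_sup => _ [A [finA _] <-].
have /finite_seqP[r Ar] := finA.
pose N := (\max_(a <- r) (deg a).+1)%N.
apply: (@le_trans _ _ (\sum_(a \in [set` cube n N]) `|(F a)%:E|)%E).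
  apply: lee_fsum_nneg_subset => //; first exact: finite_seq.
  apply/subsetP => a; rewrite Ar/= => ra; apply: deg_cube.
  exact: (@leq_bigmax_seq _ r xpredT (fun a => (deg a).+1)).
rewrite -fsbig_seq ?cube_uniq// (eq_bigr (fun a => (F a)%:E)) => [|a _]; last exact: absF.
by rewrite sumEFin lee_fin.
Qed.

End SummableCubes.

(** * Power series and their restrictions to complex lines *)

Section PowerSeries.
Variables (R : realType) (n : nat).
Local Notation mi := {ffun 'I_n -> nat}.
Local Notation vec := 'rV[R[i]]_n.
Implicit Types (a b : mi) (c : mi -> R[i]) (h u z : vec) (f : vec -> R[i]).

Lemma cmod_monomial_le a h (r : R) : (forall i, cmod (h 0 i) <= r) ->
  cmod (monomial a h) <= r ^+ deg a.
Proof.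
move=> hr; rewrite cmod_prod -prodrXr ler_prod// => i _.
rewrite cmod_ge0 cmodX lerXn2r ?nnegrE ?cmod_ge0//.
by rewrite (le_trans _ (hr i)) ?cmod_ge0.
Qed.

Lemma monomialZ (x : R[i]) a u : monomial a (x *: u) = x ^+ deg a * monomial a u.
Proof.
rewrite /monomial -prodrXr -big_split; apply: eq_bigr => i _.
by rewrite mxE exprMn.
Qed.

Lemma power_seriesP c h (s : R[i]) : power_series_sums_to c h s <->
  (exists B, forall N, \sum_(a <- cube n N) cmod (c a * monomial a h) <= B) /\
  (forall e : R, 0 < e -> exists N, forall k, (N <= k)%N ->
    cmod (s - \sum_(a <- cube n k) c a * monomial a h) <= e).
Proof.
rewrite /power_series_sums_to cvg_cmodP.
split=> -[].
  move=> /(summable_cubesP (fun a => cmod_ge0 (c a * monomial a h))) sB sl.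
  split => // e /sl[N HN].
  by exists N => k /HN; rewrite (big_cube _ (fun a => c a * monomial a h)).
move=> sB sl; split; first exact/(summable_cubesP (fun a => cmod_ge0 (c a * monomial a h))).
move=> e /sl[N HN].
by exists N => k /HN; rewrite (big_cube _ (fun a => c a * monomial a h)).
Qed.

(** The homogeneous part of degree [k]; the cube of side [k.+1] already contains all multi-indices
    of that degree. *)
Definition hom_part c (k : nat) u : R[i] :=
  \sum_(a <- cube n k.+1 | deg a == k) c a * monomial a u.

Lemma sum_hom_part c (k : nat) (x : R[i]) u :
  \sum_(j < k) hom_part c j u * x ^+ j =
  \sum_(a <- cube n k | (deg a < k)%N) c a * monomial a (x *: u).
Proof.
elim: k => [|k ih]; first by rewrite big_ord0 big_pred0.
rewrite big_ord_recr /= {}ih [RHS](bigID (fun a => deg a == k))/= addrC.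
congr (_ + _).
  rewrite /hom_part mulr_suml; apply: eq_big => [a|a /eqP ak].
    by rewrite ltnS; case: eqVneq => [->|]; rewrite ?leqnn ?andbF.
  by rewrite monomialZ ak mulrCA mulrC.
rewrite -[LHS](@big_cube_deg _ _ k.+1)//; apply: eq_bigl => a.
by rewrite ltnS ltn_neqAle andbC.
Qed.

(** The absolute sums at [d%:C *: u] are bounded by some [B]. Passing to [x *: u] multiplies each
    term of degree at least [k] by at most [(cmod x / d) ^+ k], whence the constant [B / d ^+ k]. *)
Lemma line_expansion f c z u (r : R) : 0 < r ->
  (forall h, (forall i, cmod (h 0 i) < r) -> power_series_sums_to c h (f (z + h))) ->
  forall k, exists K d : R, 0 < d /\ forall x, cmod x <= d ->
    cmod (f (z + x *: u) - \sum_(j < k) hom_part c j u * x ^+ j) <= K * cmod x ^+ k.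
Proof.
move=> r0 ps k.
pose W := \sum_i cmod (u 0 i).
have W0 : 0 <= W by apply: sumr_ge0 => i _; exact: cmod_ge0.
have W1 : 0 < W + 1 by rewrite ltr_wpDl.
pose d := r / (W + 1); have d0 : 0 < d by rewrite divr_gt0.
have small x : cmod x <= d -> forall i, cmod ((x *: u) 0 i) < r.
  move=> xd i; rewrite mxE cmodM.
  have uW : cmod (u 0 i) <= W.
    by rewrite /W (bigD1 i)//= lerDl sumr_ge0// => j _; exact: cmod_ge0.
  apply: (@le_lt_trans _ _ (d * W)); first by rewrite ler_pM ?cmod_ge0.
  by rewrite /d mulrAC ltr_pdivrMr// ltr_pM2l// ltrDl.
clearbody d.
have dd : cmod d%:C <= d by rewrite cmodR gtr0_norm.
have [[B HB] _] := (power_seriesP _ _ _).1 (ps _ (small _ dd)).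
exists (B / d ^+ k), d; split => // x xd.
have [_ lim] := (power_seriesP _ _ _).1 (ps _ (small _ xd)).
apply/ler_addgt0Pr => e e0; have [N HN] := lim _ e0.
(* A side of at least [k] puts all indices of degree below [k] into the cube, so that subtracting
   the polynomial leaves only terms of degree at least [k]. *)
pose m := maxn N k; have := HN m (leq_maxl _ _).
set S := \sum_(a <- cube n m) _ => HS.
rewrite (le_trans (cmod_distD S _ _))// addrC lerD//.
rewrite sum_hom_part -(@big_cube_deg _ _ m)//; last exact: leq_maxr.
rewrite /S (bigID (fun a => deg a < k)%N)/= addrC addrK.
rewrite (le_trans (cmod_sum _ _ _))// mulrAC -mulrA -expr_div_n.
apply: (@le_trans _ _ (\sum_(a <- cube n m | ~~ (deg a < k)%N)
    cmod (c a * monomial a (d%:C *: u)) * (cmod x / d) ^+ k)).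
  apply: ler_sum => a; rewrite -leqNgt => ka.
  rewrite !monomialZ !cmodM !cmodX cmodR (gtr0_norm d0).
  rewrite mulrCA (mulrCA (cmod (c a))) mulrAC ler_wpM2r ?mulr_ge0 ?cmod_ge0//.
  rewrite -(subnK ka) !exprD expr_div_n.
  rewrite (_ : d ^+ _ * _ * _ = d ^+ (deg a - k) * cmod x ^+ k); last first.
    by field; rewrite expf_neq0 ?gt_eqF.
  by rewrite ler_wpM2r ?exprn_ge0 ?cmod_ge0// lerXn2r ?nnegrE ?cmod_ge0// ltW.
rewrite -mulr_suml ler_wpM2r ?exprn_ge0 ?divr_ge0 ?cmod_ge0 ?(ltW d0)//.
apply: le_trans (HB m); rewrite [leRHS](bigID (fun a => deg a < k)%N)/= lerDr.
by rewrite sumr_ge0// => a _; exact: cmod_ge0.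
Qed.

Lemma line_jet f z u (x : R[i]) k : analytic_at f (z + x *: u) ->
  jet (fun t => f (z + t *: u)) x k.
Proof.
move=> [c [r [r0 ps]]].
have [K [d [d0 H]]] := line_expansion u r0 ps k.
apply: (@jetP _ _ _ _ (\poly_(j < k) hom_part c j u) K d) => // h hd.
by rewrite horner_poly scalerDl addrA H.
Qed.

End PowerSeries.

(** * Discrete Cauchy estimates by averaging over roots of unity *)

Section CauchyEstimates.
Variables (R : realType) (n : nat).
Local Notation mi := {ffun 'I_n -> nat}.
Local Notation vec := 'rV[R[i]]_n.
Implicit Types (a b : mi) (c : mi -> R[i]) (h u z : vec) (f : vec -> R[i]).

(** A [2 ^ m]-th root of -1 has order dividing [2 ^ m.+1] but not [2 ^ m]. *)
Lemma prim_root_expn2 (C : numClosedFieldType) (m : nat) :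
  exists x : C, (2 ^ m.+1).-primitive_root x.
Proof.
pose x : C := (2 ^ m).-root (-1).
have xm : x ^+ (2 ^ m) = -1 by rewrite rootCK// expn_gt0.
have xm1 : x ^+ (2 ^ m.+1) = 1 by rewrite expnSr exprM xm sqrrN expr1n.
have [N xN] := prim_order_exists (expn_gt0 2 m.+1 : (0 < 2 ^ m.+1)%N) xm1.
move=> /dvdn_pfactor[]// j jm Nj; exists x.
suff -> : m.+1 = j by rewrite -Nj.
apply/eqP; rewrite eqn_leq jm andbT ltnNge; apply/negP => jm'.
have : x ^+ (2 ^ m) = 1 by apply/eqP; rewrite -(prim_order_dvd xN) Nj dvdn_exp2l.
by rewrite xm => /eqP; rewrite eq_sym -subr_eq0 opprK (_ : 1 + 1 = 2%:R)// pnatr_eq0.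
Qed.

(** Orthogonality of characters: for distinct [i] and [j] this is a geometric sum whose ratio
    satisfies [y ^+ N = 1] and [y != 1]. *)
Lemma sum_prim_root (C : fieldType) (N : nat) (x : C) (i j : nat) :
  N.-primitive_root x -> (i < N)%N -> (j < N)%N ->
  \sum_(t < N) x ^+ (t * i) * (x ^+ (t * j))^-1 = if i == j then N%:R else 0.
Proof.
move=> xN iN jN; have N0 := prim_order_gt0 xN.
have x0 : x != 0.
  apply/eqP => x0; have := prim_expr_order xN.
  by rewrite x0 expr0n gtn_eqF// => /esym/eqP; rewrite oner_eq0.
pose y := x ^+ i / x ^+ j.
rewrite (eq_bigr (fun t : 'I_N => y ^+ t)); last first.
  by move=> t _; rewrite /y expr_div_n -!exprM ![(_ * t)%N]mulnC.
case: eqVneq => [ij|ij].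
  rewrite (eq_bigr (fun=> 1)) => [|t _]; first by rewrite sumr_const card_ord.
  by rewrite /y ij divff ?expf_neq0// expr1n.
have y1 : y - 1 != 0.
  rewrite subr_eq0; apply: contra ij => /eqP yE.
  have : x ^+ i == x ^+ j by rewrite -[eqbLHS](divfK (expf_neq0 j x0)) -/y yE mul1r.
  by rewrite (eq_prim_root_expr xN) !modn_small.
apply: (mulfI y1); rewrite -subrX1 mulr0 /y expr_div_n -!exprM ![(_ * N)%N]mulnC.
by rewrite !exprM (prim_expr_order xN) !expr1n divr1 subrr.
Qed.

(** Averaging [hom_part c k] over the points whose coordinates are [r] times [N]-th roots of unity,
    with the unimodular weights [w], isolates [c a]. Taking [N] above [k] separates all exponents
    that occur. *)
Lemma hom_part_coef_le c (k : nat) (r B : R) : 0 < r ->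
  (forall u, (forall i, cmod (u 0 i) <= r) -> cmod (hom_part c k u) <= B) ->
  forall a, deg a = k -> cmod (c a) * r ^+ k <= B.
Proof.
move=> r0 HB a ak.
have [x xN] := prim_root_expn2 R[i] k.
set N := (2 ^ k.+1)%N in xN.
have kN : (k < N)%N by rewrite (ltn_trans (ltnSn k))// ltn_expl.
have N0 : (0 < N)%N by rewrite expn_gt0.
have cx : cmod x = 1.
  have /eqP := congr1 (fun t => cmod t) (prim_expr_order xN).
  by rewrite cmodX cmod1 pexprn_eq1 ?cmod_ge0// gtn_eqF// => /eqP.
pose pt (b : {ffun 'I_n -> 'I_N}) : vec := \row_i (r%:C * x ^+ b i).
pose w (b : {ffun 'I_n -> 'I_N}) : R[i] := \prod_i (x ^+ (b i * a i))^-1.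
have avg : \sum_b w b * hom_part c k (pt b) = c a * r%:C ^+ k * N%:R ^+ n.
  under eq_bigr do rewrite /hom_part mulr_sumr.
  rewrite exchange_big/=.
  have inner a' : deg a' = k -> \sum_b w b * (c a' * monomial a' (pt b)) =
      if a' == a then c a * r%:C ^+ k * N%:R ^+ n else 0.
    move=> a'k.
    transitivity (c a' * r%:C ^+ k * \prod_i (if a' i == a i then N%:R else 0)).
      rewrite (eq_bigr (fun b : {ffun 'I_n -> 'I_N} => c a' * r%:C ^+ k *
          \prod_i (x ^+ (b i * a' i) * (x ^+ (b i * a i))^-1))); last first.
        move=> b _; rewrite big_split/= -/(w b) /monomial.
        rewrite (eq_bigr (fun i => r%:C ^+ a' i * x ^+ (b i * a' i))); last first.
          by move=> i _; rewrite mxE exprMn exprM.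
        by rewrite big_split/= prodrXr -/(deg a') a'k; ring.
      rewrite -mulr_sumr; congr (_ * _).
      rewrite -(bigA_distr_bigA (fun (i : 'I_n) (t : 'I_N) =>
         x ^+ (t * a' i) * (x ^+ (t * a i))^-1)).
      apply: eq_bigr => i _; apply: sum_prim_root => //.
        by rewrite (leq_ltn_trans (leq_deg a' i))// a'k.
      by rewrite (leq_ltn_trans (leq_deg a i))// ak.
    case: eqP => [->|/eqP a'a].
      rewrite (eq_bigr (fun=> N%:R)) => [|i _]; last by rewrite eqxx.
      by rewrite prodr_const card_ord.
    have [i a'i] : exists i, a' i != a i.
      apply/existsP; rewrite -negb_forall; apply: contra a'a => /forallP H.
      by apply/eqP/ffunP => i; apply/eqP.
    by rewrite (bigD1 i)//= (negbTE a'i) mul0r mulr0.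
  rewrite (eq_bigr _ (fun a' a'k => inner a' (eqP a'k))).
  rewrite -big_mkcondr (big_rem a) /=; last by apply: deg_cube; rewrite ak.
  rewrite ak !eqxx /= big1_seq ?addr0// => a' /andP[/andP[_ /eqP ->]].
  by rewrite mem_rem_uniqF// cube_uniq.
have : cmod (c a * r%:C ^+ k * N%:R ^+ n) <= N%:R ^+ n * B.
  rewrite -avg (le_trans (cmod_sum _ _ _))//.
  rewrite (_ : N%:R ^+ n * B = \sum_(b : {ffun 'I_n -> 'I_N}) B); last first.
    by rewrite sumr_const card_ffun !card_ord -[RHS]mulr_natl natrX.
  apply: ler_sum => b _; rewrite cmodM cmod_prod big1 => [|i _]; last first.
    by rewrite cmodV cmodX cx expr1n invr1.
  by rewrite mul1r; apply: HB => i; rewrite mxE cmodM cmodX cx expr1n mulr1 cmodR gtr0_norm.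
rewrite !cmodM !cmodX cmodR gtr0_norm// cmod_nat mulrC ler_pM2l//.
by rewrite exprn_gt0// ltr0n.
Qed.

End CauchyEstimates.

(** * Uniform expansions on polydiscs, limits and extremizers in the Schur class *)

Section Expansions.
Variables (R : realType) (n : nat).
Local Notation mi := {ffun 'I_n -> nat}.
Local Notation vec := 'rV[R[i]]_n.
Implicit Types (a b : mi) (c : mi -> R[i]) (h u z : vec) (f g : vec -> R[i]).

Lemma unit_ball_polydisc z : unit_ball z -> exists2 r : R, 0 < r &
  forall h, (forall i, cmod (h 0 i) <= r) -> unit_ball (z + h).
Proof.
rewrite /unit_ball /mkset => zB.
set S := \sum_(i < n) _ in zB.
have n30 : 0 < 3 * n%:R + 1 :> R by rewrite ltr_wpDl// mulr_ge0.
(* With all moduli at most 1, a shift by at most [r] adds at most [2 * r + r ^+ 2 <= 3 * r] to each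
   squared modulus, and [n] such terms stay below [1 - S]. *)
pose r := Num.min 1 ((1 - S) / (3 * n%:R + 1)).
have r0 : 0 < r by rewrite lt_min ltr01 divr_gt0// subr_gt0.
have r1 : r <= 1 by rewrite ge_min lexx.
have rS : 3 * n%:R * r < 1 - S.
  have : r * (3 * n%:R + 1) <= 1 - S.
    by rewrite -ler_pdivlMr// /r ge_min lexx orbT.
  by move: r0; clearbody r; lra.
exists r => // h hr.
have z1 i : cmod (z 0 i) <= 1.
  rewrite -(@ler_pXn2r _ 2)// ?nnegrE ?cmod_ge0// expr1n (le_trans _ (ltW zB))//.
  by rewrite /S (bigD1 i)//= lerDl sumr_ge0// => j _; exact: sqr_ge0.
apply: (@le_lt_trans _ _ (\sum_(i < n) (cmod (z 0 i) ^+ 2 + 3 * r))).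
  apply: ler_sum => i _; rewrite mxE.
  have : cmod (z 0 i + h 0 i) ^+ 2 <= (cmod (z 0 i) + r) ^+ 2.
    rewrite ler_pXn2r ?nnegrE ?addr_ge0 ?cmod_ge0 ?(ltW r0)//.
    by rewrite (le_trans (cmodD _ _))// lerD2l.
  have := z1 i; have := cmod_ge0 (z 0 i); move: r0 r1; clearbody r.
  nra.
rewrite big_split/= sumr_const card_ord -/S -mulr_natl.
by move: rS; clearbody r; lra.
Qed.

Section AtPoint.
Variables (f : vec -> R[i]) (z : vec) (r : R).
Hypothesis r0 : 0 < r.
Hypothesis f_analytic : forall y, unit_ball y -> analytic_at f y.
Hypothesis f_le1 : forall y, unit_ball y -> cmod (f y) <= 1.
Hypothesis polydisc : forall h, (forall i, cmod (h 0 i) <= r) -> unit_ball (z + h).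

(** The family [c] comes from an expansion on some small polydisc depending on [f], but on each line
    through [z] the one-variable estimates hold as far as the polydisc of radius [r] reaches. *)
Let f_expansion : exists c, forall (T : R) u, 0 < T ->
  (forall i, T * cmod (u 0 i) <= r) -> forall k,
  cmod (hom_part c k u) <= (2 / T) ^+ k /\
  forall x, cmod x <= T ->
    cmod (f (z + x *: u) - \sum_(j < k) hom_part c j u * x ^+ j)
      <= (2 / T) ^+ k * cmod x ^+ k.
Proof.
have zB : unit_ball z.
  by rewrite -[z]addr0; apply: polydisc => i; rewrite mxE cmod0 ltW.
have [c [d [d0 ps]]] := f_analytic zB; exists c => T u T0 Tu k.
have inball x : cmod x <= T -> unit_ball (z + x *: u).
  move=> xT; apply: polydisc => i; rewrite mxE cmodM.
  by rewrite (le_trans _ (Tu i))// ler_wpM2r ?cmod_ge0.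
have le1 x : cmod x <= T -> cmod (f (z + x *: u)) <= 1 by move=> /inball/f_le1.
have jets x : cmod x <= T -> jet (fun t => f (z + t *: u)) x 3.
  by move=> /inball/f_analytic/line_jet.
have expd := line_expansion u d0 ps.
split.
  have := schwarz_coefficient (s := fun j => hom_part c j u) T0 le1 jets expd k.
  by rewrite mul1r.
move=> x xT.
have := schwarz_remainder (s := fun j => hom_part c j u) T0 le1 jets expd k xT.
by rewrite mul1r.
Qed.

(** Lines with [T = 1] bound the coefficients; [T = 8] at [x = 1] bounds the truncation by degree.
    The cube has further terms of degree at least [N], with sum at most [2 ^+ n / 2 ^+ N]. Neither
    bound depends on [f]. *)
Lemma schur_expansion : exists c,
  (forall a, cmod (c a) * r ^+ deg a <= 2 ^+ deg a) /\
  (forall h (N : nat), (forall i, 8 * cmod (h 0 i) <= r) ->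
    cmod (f (z + h) - \sum_(a <- cube n N) c a * monomial a h)
      <= (2 ^+ n + 1) / 2 ^+ N).
Proof.
have [c Hc] := f_expansion; exists c.
have coef a : cmod (c a) * r ^+ deg a <= 2 ^+ deg a.
  apply: (hom_part_coef_le r0 _ (erefl (deg a))) => u ur.
  by have [|+ _] := Hc 1 u ltr01 _ (deg a); [move=> i; rewrite mul1r|rewrite divr1].
split=> // h N hr.
have [|i|_ /(_ 1)] := Hc 8 h _ _ N => //.
rewrite scale1r cmod1 expr1n mulr1 sum_hom_part scale1r.
have -> : (1 : R) <= 8 by lra.
move=> /(_ isT); set S := \sum_(a <- cube n N | _) _ => HS.
rewrite (le_trans (cmod_distD S _ _))// addrC mulrDl mul1r lerD//; last first.
  rewrite (le_trans HS)// -exprVn lerXn2r// ?nnegrE; lra.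
rewrite cmod_distC [X in X - S](bigID (fun a => deg a < N)%N)/= addrC addrK.
rewrite (le_trans (cmod_sum _ _ _))//.
(* Each term is at most [4^-1 ^+ deg a]: one factor [2^-1 ^+ deg a] yields the division by [2 ^+ N],
   the other is summed as a geometric series. *)
apply: (@le_trans _ _ (\sum_(a <- cube n N | ~~ (deg a < N)%N) 2^-1 ^+ deg a / 2 ^+ N)).
  apply: ler_sum => a; rewrite -leqNgt => Na; rewrite cmodM.
  have hr8 : cmod (monomial a h) <= (r / 8) ^+ deg a.
    by apply: cmod_monomial_le => i; have := hr i; lra.
  apply: (@le_trans _ _ (cmod (c a) * (r / 8) ^+ deg a)).
    by rewrite ler_wpM2l ?cmod_ge0.
  rewrite expr_div_n mulrA ler_pdivrMr ?exprn_gt0//; apply: (le_trans (coef a)).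
  have -> : 2^-1 ^+ deg a / 2 ^+ N * 8 ^+ deg a = 2 ^+ deg a * (2 ^+ deg a / 2 ^+ N) :> R.
    rewrite (_ : 8 = 2 * 2 * 2 :> R); last by ring.
    by rewrite !exprMn exprVn; field; rewrite !expf_neq0.
  by rewrite ler_peMr ?exprn_ge0// ler_pdivlMr ?exprn_gt0// mul1r ler_weXn2l// ler1n.
rewrite -mulr_suml ler_wpM2r ?invr_ge0 ?exprn_ge0//.
have half1 : (2^-1 : R) < 1 by lra.
have half0 : 0 <= (2^-1 : R) by lra.
have := sum_cube_geometric n N half0 half1.
rewrite (_ : (1 - 2^-1)^-1 = 2 :> R); last by field.
apply: le_trans; rewrite [leRHS](bigID (fun a => deg a < N)%N)/= lerDr.
by rewrite sumr_ge0// => a _; exact: exprn_ge0.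
Qed.

(** A weak Schwarz lemma: the remainder of order 1 with [T = 1], where [2 / T] gives the
    constant. *)
Lemma schur_lipschitz u (x : R[i]) : (forall i, cmod (u 0 i) <= r) -> cmod x <= 1 ->
  cmod (f (z + x *: u) - f z) <= 2 * cmod x.
Proof.
move=> ur x1; have [c Hc] := f_expansion.
have [|_ H] := Hc 1 u ltr01 _ 1; first by move=> i; rewrite mul1r.
have := H 0; rewrite cmod0 scale0r addr0 big_ord_recl big_ord0 addr0 !expr0 mulr1.
rewrite !expr1 mulr0 => /(_ ler01); rewrite le_eqVlt ltNge cmod_ge0 orbF cmod_eq0.
rewrite subr_eq0 => /eqP fz.
have := H x x1; rewrite big_ord_recl big_ord0 addr0 expr0 mulr1 -fz.
by rewrite !expr1 divr1.
Qed.

End AtPoint.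

(** A converse to [schur_expansion]: on the polydisc of radius [r / 8] the coefficient bound
    dominates the series by [4^-1 ^+ deg a], and the second estimate identifies its sum. *)
Lemma analytic_at_expansion f z c (r K : R) : 0 < r ->
  (forall a, cmod (c a) * r ^+ deg a <= 2 ^+ deg a) ->
  (forall h (N : nat), (forall i, 8 * cmod (h 0 i) <= r) ->
    cmod (f (z + h) - \sum_(a <- cube n N) c a * monomial a h) <= K / 2 ^+ N) ->
  analytic_at f z.
Proof.
move=> r0 coef approx; exists c, (r / 8); split; first by rewrite divr_gt0.
move=> h hr; apply/power_seriesP.
have hr8 i : 8 * cmod (h 0 i) <= r by have := hr i; lra.
split.
  exists ((1 - 4^-1)^-1 ^+ n) => N.
  apply: le_trans (sum_cube_geometric n N (t := 4^-1) _ _); [|lra|lra].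
  apply: ler_sum => a _; rewrite cmodM.
  apply: (@le_trans _ _ (cmod (c a) * (r / 8) ^+ deg a)).
    by rewrite ler_wpM2l ?cmod_ge0// cmod_monomial_le// => i; exact: ltW.
  rewrite expr_div_n mulrA ler_pdivrMr ?exprn_gt0//; apply: (le_trans (coef a)).
  by rewrite -exprMn lerXn2r ?nnegrE; lra.
(* Since [k < 2 ^ k], every [k] above the quotient of the modulus of [K] by [e] works. *)
move=> e e0; pose N := Num.truncn (`|K| / e).
have KN : `|K| / e < N.+1%:R by exact: truncnS_gt.
exists N.+1 => k Nk; apply: (le_trans (approx h k hr8)).
rewrite ler_pdivrMr ?exprn_gt0// (le_trans (ler_norm K))//.
rewrite -ler_pdivrMl// mulrC (le_trans (ltW KN))// -natrX ler_nat.
by rewrite (leq_trans Nk)// ltnW// ltn_expl.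
Qed.

Lemma schur_classP f : schur_class f <->
  (forall z, unit_ball z -> analytic_at f z) /\ forall z, unit_ball z -> cmod (f z) <= 1.
Proof.
have z0 : unit_ball (0 : vec).
  by rewrite /unit_ball /mkset big1// => i _; rewrite mxE cmod0 expr0n.
split=> [[[fa [M HM]] fn]|[fa f1]].
  split=> // z zB; apply: le_trans fn; apply: ub_le_sup; last by exists z.
  by exists M => _ [y yB <-]; exact: HM.
split; first by split => //; exists 1.
apply: ge_sup; first by exists (cmod (f 0)), 0.
by move=> _ [y yB <-]; exact: f1.
Qed.

Lemma cmod_le_norm_oo f z : Hoo f -> unit_ball z -> cmod (f z) <= norm_oo f.
Proof.
move=> [_ [M HM]] zB; apply: ub_le_sup; last by exists z.
by exists M => _ [y yB <-]; exact: HM.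
Qed.

(** A Montel-type argument: the coefficients at [z] converge along [U], and the uniform estimates of
    [schur_expansion] pass to the limit, where [analytic_at_expansion] applies. *)
Lemma schur_ultra_limit (U : set_system (vec -> R[i])) (phi : vec -> R[i]) :
  UltraFilter U -> U (@schur_class R n) ->
  (forall z, unit_ball z -> forall e : R, 0 < e -> U [set g | cmod (g z - phi z) <= e]) ->
  schur_class phi.
Proof.
move=> UU US Uphi; apply/schur_classP; split=> z zB; last first.
  rewrite -[phi z]subr0; apply: (@ultra_lim_le _ _ U (fun g => g z)) => //.
    exact: Uphi.
  by apply: filterS US => g /schur_classP[_ /(_ _ zB)]; rewrite /mkset subr0.
have [r r0 polydisc] := unit_ball_polydisc zB.
(* A coefficient family is fixed for every [g], with the arbitrary value 0 outside the Schur
   class. *)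
have /choice[C HC] : forall g, exists c, schur_class g ->
  (forall a, cmod (c a) * r ^+ deg a <= 2 ^+ deg a) /\
  (forall h (N : nat), (forall i, 8 * cmod (h 0 i) <= r) ->
    cmod (g (z + h) - \sum_(a <- cube n N) c a * monomial a h)
      <= (2 ^+ n + 1) / 2 ^+ N).
  move=> g; have [|ng] := pselect (schur_class g); last by exists (fun=> 0).
  move=> /schur_classP[ga g1]; have [c Hc] := schur_expansion r0 ga g1 polydisc.
  by exists c.
have rd (a : mi) : 0 < r ^+ deg a by rewrite exprn_gt0.
have /choice[d Hd] : forall a, exists l, forall e : R, 0 < e ->
    U [set g | cmod (C g a - l) <= e].
  move=> a; apply: (@ultra_lim _ _ U (fun g => C g a) (2 ^+ deg a / r ^+ deg a)) => //.
  apply: filterS US => g Sg; rewrite /mkset ler_pdivlMr//.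
  by have [+ _] := HC _ Sg; apply.
apply: (@analytic_at_expansion _ _ d r (2 ^+ n + 1)) => // [a|h N hr].
  rewrite -ler_pdivlMr// -[d a]subr0.
  apply: (@ultra_lim_le _ _ U (fun g => C g a)) => //; first exact: Hd.
  apply: filterS US => g Sg; rewrite /mkset subr0 ler_pdivlMr//.
  by have [+ _] := HC _ Sg; apply.
set S := \sum_(a <- cube n N) _.
rewrite -[X in cmod X]subr0.
apply: (@ultra_lim_le _ _ U (fun g =>
  g (z + h) - \sum_(a <- cube n N) C g a * monomial a h)) => //; last first.
  apply: filterS US => g Sg; rewrite /mkset subr0.
  by have [_ +] := HC _ Sg; apply.
have hr' i : cmod (h 0 i) <= r by have := hr i; have := cmod_ge0 (h 0 i); lra.
have {}Uphi := Uphi _ (polydisc _ hr').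
(* The partial sum is finite, so its limit is taken term by term, by induction on the list of
   indices. *)
have Usum : forall e : R, 0 < e ->
    U [set g | cmod (\sum_(a <- cube n N) C g a * monomial a h - S) <= e].
  rewrite /S; elim: (cube n N) => [|a s ih] e e0.
    by apply: filterS US => g _; rewrite /mkset !big_nil subr0 cmod0 ltW.
  have e20 : 0 < e / 2 by lra.
  pose m := cmod (monomial a h) + 1.
  have m0 : 0 < m by rewrite ltr_wpDl ?cmod_ge0.
  apply: filterS (filterI (ih _ e20) (Hd a _ (divr_gt0 e20 m0))) => g; rewrite /mkset.
  move=> [H1 H2]; rewrite !big_cons opprD addrACA -mulrBl.
  rewrite (le_trans (cmodD _ _))// (splitr e) lerD// cmodM.
  apply: (@le_trans _ _ (e / 2 / m * m)); last by rewrite divfK// gt_eqF.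
  by rewrite ler_pM ?cmod_ge0// /m lerDl.
move=> e e0; have e20 : 0 < e / 2 by lra.
apply: filterS (filterI (Uphi _ e20) (Usum _ e20)) => g; rewrite /mkset => -[H1 H2].
rewrite (_ : _ - _ - _ = (g (z + h) - phi (z + h)) -
  (\sum_(a <- cube n N) C g a * monomial a h - S)); last by ring.
by rewrite (le_trans (cmodB _ _))// (splitr e) lerD.
Qed.

(** [phi] is a pointwise limit along an ultrafilter maximizing [cmod (g y)]. As [P] is not assumed
    closed, the last clause records that values common to all of [P] survive in the limit. *)
Lemma schur_extremizer (P : set (vec -> R[i])) (y : vec) :
  unit_ball y -> P !=set0 -> P `<=` @schur_class R n ->
  exists phi, [/\ schur_class phi,
    forall g, P g -> cmod (g y) <= cmod (phi y) &
    forall z w, unit_ball z -> (forall g, P g -> g z = w) -> phi z = w].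
Proof.
move=> yB P0 PS.
have [U [UU UP Umax]] := maximizing_ultra (fun g => cmod (g y)) P0.
have US : U (@schur_class R n) by exact: filterS UP.
have /choice[phi Hphi] : forall z, exists l, unit_ball z ->
    forall e : R, 0 < e -> U [set g | cmod (g z - l) <= e].
  move=> z; have [zB|nzB] := pselect (unit_ball z); last by exists 0.
  have [|l Hl] := @ultra_lim _ _ U (fun g => g z) 1 UU; last by exists l.
  by apply: filterS US => g /schur_classP[_ /(_ _ zB)].
exists phi; split.
- exact: schur_ultra_limit US Hphi.
- move=> g Pg; apply/ler_addgt0Pr => e e0.
  have [k /= gk kphi] := ultra_meets UU (Umax _ Pg) (Hphi _ yB _ e0).
  apply: (le_trans gk); rewrite -[k y](subrK (phi y)) addrC.
  by rewrite (le_trans (cmodD _ _))// lerD2l.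
- move=> z w zB Pw; apply/eqP; rewrite -subr_eq0 -cmod_eq0 eq_le cmod_ge0 andbT.
  apply: (@ultra_lim_le _ _ U (fun g => g z)) => //; first exact: Hphi.
  by apply: filterS UP => g /Pw; rewrite /mkset => ->; rewrite subrr cmod0.
Qed.

End Expansions.

(** * Analyticity of polynomials in one coordinate and of linear combinations *)

Section AnalyticFunctions.
Variables (R : realType) (n : nat).
Local Notation mi := {ffun 'I_n -> nat}.
Local Notation vec := 'rV[R[i]]_n.
Implicit Types (f g : vec -> R[i]) (z h : vec).

(** The multiples of the unit multi-index at [i0] are the only indices in the expansion of a
    polynomial in the coordinate [i0]. *)
Definition axis_index (i0 : 'I_n) (k : nat) : mi :=
  [ffun i => if i == i0 then k else 0%N].

Definition on_axis (i0 : 'I_n) (a : mi) : bool := a == axis_index i0 (a i0).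

Lemma sum_cube_axis (V : nmodType) (i0 : 'I_n) (F : mi -> V) N :
  \sum_(a <- cube n N | on_axis i0 a) F a =
  \sum_(k < N) F (axis_index i0 k).
Proof.
rewrite -big_filter -(big_mkord xpredT (fun k => F (axis_index i0 k))).
rewrite -[RHS](big_map (axis_index i0) xpredT F); apply: perm_big.
apply: uniq_perm; first by rewrite filter_uniq ?cube_uniq.
  rewrite map_inj_uniq ?iota_uniq// => k l /ffunP/(_ i0).
  by rewrite !ffunE eqxx.
move=> a; rewrite mem_filter mem_cube; apply/andP/mapP.
  move=> [/eqP aE /forallP aN]; exists (a i0) => //.
  by rewrite mem_index_iota aN.
move=> [k + ->]; rewrite mem_index_iota => kN; split.
  by rewrite /on_axis ffunE !eqxx.
by apply/forallP => i; rewrite ffunE; case: ifP => // _; exact: leq_ltn_trans kN.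
Qed.

(** The coefficients are those of [q] translated by [z 0 i0], placed on the axis [i0], so the series
    is a finite sum. *)
Lemma analytic_at_horner (q : {poly R[i]}) (i0 : 'I_n) z :
  analytic_at (fun y => q.[y 0 i0]) z.
Proof.
pose p := q \Po ('X + (z 0 i0)%:P).
pose c (a : mi) := if on_axis i0 a then p`_(a i0) else 0.
exists c, 1; split => // h _.
have mono k : monomial (axis_index i0 k) h = h 0 i0 ^+ k.
  rewrite /monomial (bigD1 i0)//= ffunE eqxx big1 ?mulr1// => i ii0.
  by rewrite ffunE (negbTE ii0).
have cE k : c (axis_index i0 k) = p`_k by rewrite /c /on_axis ffunE !eqxx.
apply/power_seriesP; split.
  exists (map_poly (fun x => cmod x) p).[cmod (h 0 i0)] => N.
  apply: (@le_trans _ _ (\sum_(a <- cube n (maxn N (size p))) cmod (c a * monomial a h))).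
    by apply: sum_cube_le_mono; [exact: leq_maxl|move=> a; exact: cmod_ge0].
  rewrite (bigID (on_axis i0))/= [X in _ + X]big1; last first.
    by move=> a ax; rewrite /c (negbTE ax) mul0r cmod0.
  rewrite addr0 sum_cube_axis (@horner_coef_wide _ (maxn N (size p))); last first.
    by rewrite (leq_trans (size_poly _ _))// leq_maxr.
  apply: ler_sum => k _; rewrite cE mono cmodM cmodX coef_map_id0//.
  exact: cmod0.
move=> e e0; exists (size p) => k pk.
rewrite (bigID (on_axis i0))/= [X in _ - (_ + X)]big1; last first.
  by move=> a ax; rewrite /c (negbTE ax) mul0r.
rewrite addr0 sum_cube_axis (eq_bigr (fun j : 'I_k => p`_j * h 0 i0 ^+ j)); last first.
  by move=> j _; rewrite cE mono.
rewrite -horner_coef_wide// /p horner_comp hornerD hornerX hornerC mxE.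
by rewrite (addrC (h 0 i0)) subrr cmod0 ltW.
Qed.

Lemma analytic_at_linear f g (x : R[i]) z : analytic_at f z -> analytic_at g z ->
  analytic_at (fun y => f y + x * g y) z.
Proof.
move=> [c [r [r0 Hc]]] [d [s [s0 Hd]]].
exists (fun a => c a + x * d a), (Num.min r s); split; first by rewrite lt_min r0.
move=> h hrs.
have [|[B HB] limf] := (power_seriesP _ _ _).1 (Hc h _).
  by move=> i; have := hrs i; rewrite lt_min => /andP[].
have [|[D HD] limg] := (power_seriesP _ _ _).1 (Hd h _).
  by move=> i; have := hrs i; rewrite lt_min => /andP[].
have x1 : 0 < cmod x + 1 by rewrite ltr_wpDl ?cmod_ge0.
apply/power_seriesP; split.
  exists (B + cmod x * D) => N; apply: (@le_trans _ _
    (\sum_(a <- cube n N) (cmod (c a * monomial a h) + cmod x * cmod (d a * monomial a h)))).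
    by apply: ler_sum => a _; rewrite mulrDl -mulrA -(cmodM x) cmodD.
  by rewrite big_split/= -mulr_sumr lerD// ler_wpM2l ?cmod_ge0.
move=> e e0; have e20 : 0 < e / 2 by lra.
have [N HN] := limf _ e20; have [M HM] := limg _ (divr_gt0 e20 x1).
exists (maxn N M) => k; rewrite geq_max => /andP[/HN fk /HM gk].
rewrite (eq_bigr (fun a => c a * monomial a h + x * (d a * monomial a h))); last first.
  by move=> a _; rewrite mulrDl -mulrA.
rewrite big_split/= -mulr_sumr opprD addrACA -mulrBr.
rewrite (le_trans (cmodD _ _))// (splitr e) lerD// cmodM.
apply: (@le_trans _ _ ((cmod x + 1) * (e / 2 / (cmod x + 1)))).
  by rewrite ler_pM ?cmod_ge0// lerDl.
by rewrite mulrC divfK// gt_eqF.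
Qed.

Lemma unit_ball_coord_le1 z i : unit_ball z -> cmod (z 0 i) <= 1.
Proof.
move=> zB; rewrite -(@ler_pXn2r _ 2)// ?nnegrE ?cmod_ge0// expr1n.
apply: le_trans (ltW zB); rewrite (bigD1 i)//= lerDl sumr_ge0// => j _.
exact: sqr_ge0.
Qed.

End AnalyticFunctions.

(** * Extremality of a maximizer, and the choice of the additional node *)

Section Extremal.
Variables (R : realType) (n m : nat).
Local Notation vec := 'rV[R[i]]_n.
Implicit Types (f g : vec -> R[i]).

(* By the parallelogram law. *)
Lemma cmod_addsub_le (v x : R[i]) :
  cmod (v + x) <= cmod v -> cmod (v - x) <= cmod v -> x = 0.
Proof.
move=> H1 H2; apply/eqP; rewrite -cmod_eq0 -sqrf_eq0 eq_le sqr_ge0 andbT.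
have : cmod (v + x) ^+ 2 <= cmod v ^+ 2 by rewrite ler_pXn2r// nnegrE cmod_ge0.
have : cmod (v - x) ^+ 2 <= cmod v ^+ 2 by rewrite ler_pXn2r// nnegrE cmod_ge0.
case: v x {H1 H2} => v1 v2 [x1 x2]; rewrite !cmod_sqr/= => H1 H2; nra.
Qed.

Lemma maximal_norm_oo_eq1 (i0 : 'I_n) (z : 'I_m -> vec) (y : vec) f :
  unit_ball y -> (forall i, unit_ball (z i)) -> (forall i, y 0 i0 != z i 0 i0) ->
  schur_class f ->
  (forall g, schur_class g -> (forall i, g (z i) = f (z i)) -> cmod (g y) <= cmod (f y)) ->
  norm_oo f = 1.
Proof.
move=> yB zB yz [fH f1] fmax; apply/eqP; rewrite eq_le f1 leNgt; apply/negP => flt1.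
(* Taken at the coordinate [i0], [q] vanishes at all nodes but not at [y], which differs from each
   of them in that coordinate. *)
pose q := \prod_(i < m) ('X - (z i 0 i0)%:P).
have qle v : unit_ball v -> cmod (q.[v 0 i0]) <= 2 ^+ m.
  move=> vB; rewrite /q horner_prod cmod_prod.
  rewrite -[X in _ <= _ ^+ X]card_ord -prodr_const ler_prod// => i _.
  rewrite cmod_ge0 !hornerE (le_trans (cmodB _ _))// (_ : 2 = 1 + 1)//.
  by rewrite lerD// unit_ball_coord_le1.
(* As [q] is at most [2 ^+ m] on the ball, [eta * q] fits into the slack [1 - norm_oo f]. *)
pose eta := ((1 - norm_oo f) / 2 ^+ m)%:C.
have ceta : cmod eta = (1 - norm_oo f) / 2 ^+ m.
  by rewrite cmodR ger0_norm// divr_ge0 ?exprn_ge0// subr_ge0.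
have perturb (s : R[i]) : cmod s = 1 ->
    cmod (f y + s * eta * q.[y 0 i0]) <= cmod (f y).
  move=> s1; apply: (fmax (fun v => f v + s * eta * q.[v 0 i0])).
    apply/schur_classP; split=> v vB.
      apply: (analytic_at_linear (g := fun v => q.[v 0 i0])); last exact: analytic_at_horner.
      by case: fH => + _; apply.
    rewrite (le_trans (cmodD _ _))// -[leRHS](subrKC (norm_oo f)) lerD//.
      exact: cmod_le_norm_oo.
    rewrite !cmodM s1 mul1r ceta mulrAC ler_pdivrMr ?exprn_gt0//.
    by rewrite ler_wpM2l ?qle// subr_ge0.
  by move=> i; rewrite /q horner_prod (bigD1 i)//= hornerXsubC subrr mul0r mulr0 addr0.
have := @cmod_addsub_le (f y) (eta * q.[y 0 i0]).
have := perturb 1 (cmod1 _); rewrite mul1r => H1.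
have := perturb (-1); rewrite cmodN cmod1 mulN1r mulNr => /(_ erefl) H2.
move=> /(_ H1 H2)/eqP; rewrite mulf_eq0 => /orP[|].
  rewrite -cmod_eq0 ceta mulf_eq0 invr_eq0 expf_eq0/= pnatr_eq0 andbF orbF.
  by rewrite subr_eq0 gt_eqF.
rewrite /q horner_prod prodf_seq_eq0 => /hasP[i _ /=].
by rewrite !hornerE subr_eq0 (negbTE (yz i)).
Qed.

Lemma exists_extremal_interpolant (i0 : 'I_n) (j0 : 'I_m)
    (z : 'I_m -> vec) (w : 'I_m -> R[i]) :
  injective z -> (forall i, unit_ball (z i)) -> (forall i, unit_disc (w i)) ->
  (exists f, schur_class f /\ interpolates z w f) ->
  exists phi, extremal_functions phi /\ interpolates z w phi.
Proof.
move=> zI zB wD [f0 [f0S f0w]].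
have [r r0 polydisc] := unit_ball_polydisc (zB j0).
pose u : vec := \row_i (if i == i0 then r%:C else 0).
have ur i : cmod (u 0 i) <= r.
  by rewrite mxE; case: eqP => _; [rewrite cmodR gtr0_norm|rewrite cmod0 ltW].
(* The bound on [2 * d] will give [cmod (phi y) < 1] through [schur_lipschitz]. The last condition
   excludes only finitely many [d], so all small positive [d] qualify. *)
have [d [d0 d1 dw dz]] : exists d : R, [/\ 0 < d, d <= 1, 2 * d < 1 - cmod (w j0) &
    forall i, z j0 0 i0 + d%:C * r%:C != z i 0 i0].
  have w1 : 0 < (1 - cmod (w j0)) / 2 by rewrite divr_gt0// subr_gt0; exact: wD.
  have : \forall d \near (0:R)^'+, [/\ 0 < d, d <= 1, 2 * d < 1 - cmod (w j0) &
    forall i, z j0 0 i0 + d%:C * r%:C != z i 0 i0].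
    near=> d; split.
    - by near: d; exact: nbhs_right_gt.
    - by near: d; apply: nbhs_right_le.
    - have : d < (1 - cmod (w j0)) / 2 by near: d; exact: nbhs_right_lt.
      by lra.
    - near: d; apply: filter_forall => i; have [->|zij] := eqVneq (z i 0 i0) (z j0 0 i0).
        near=> d; rewrite addrC -subr_eq0 addrK mulf_neq0//.
          by rewrite -cmod_eq0 cmodR normr_eq0 gt_eqF.
        by rewrite -cmod_eq0 cmodR normr_eq0 gt_eqF.
      have c0 : 0 < cmod (z i 0 i0 - z j0 0 i0) / r.
        by rewrite divr_gt0// cmod_gt0 subr_eq0.
      near=> d; apply/eqP => zE.
      have : cmod (z i 0 i0 - z j0 0 i0) = d * r.
        by rewrite -zE addrC addKr cmodM !cmodR !gtr0_norm.
      have : d < cmod (z i 0 i0 - z j0 0 i0) / r by near: d; exact: nbhs_right_lt.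
      by rewrite ltr_pdivlMr// => /[swap] ->; rewrite ltxx.
  by move=> /filter_ex.
have cd : cmod d%:C = d by rewrite cmodR gtr0_norm.
pose y := z j0 + d%:C *: u.
have yB : unit_ball y.
  apply: polydisc => i; rewrite mxE cmodM cd (le_trans _ (ur i))//.
  by rewrite ler_piMl ?cmod_ge0.
have yz i : y 0 i0 != z i 0 i0 by rewrite !mxE eqxx dz.
pose P : set (vec -> R[i]) := [set g | schur_class g /\ interpolates z w g].
have [||phi [phiS phimax phiP]] := @schur_extremizer _ _ P y yB.
- by exists f0.
- by move=> g [].
have phiw : interpolates z w phi by move=> i; apply: phiP => // g [].
have phiy : cmod (phi y) < 1.
  have [phia phi1] := (schur_classP _).1 phiS.
  have cd1 : cmod d%:C <= 1 by rewrite cd.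
  have := schur_lipschitz r0 phia phi1 polydisc ur cd1.
  rewrite cd -/y phiw => H; rewrite -[phi y](subrK (w j0)).
  rewrite (le_lt_trans (cmodD _ _))//; lra.
exists phi; split => //; split => //.
(* The index [ord0] carries the new node [y], the lifted indices the old ones. *)
exists m.+1, (fun k => if unlift ord0 k is Some i then z i else y),
  (fun k => if unlift ord0 k is Some i then w i else phi y).
have phiext : interpolates (fun k : 'I_m.+1 => if unlift ord0 k is Some i then z i else y)
    (fun k => if unlift ord0 k is Some i then w i else phi y) phi.
  by move=> k; case: unliftP.
split => //.
  split=> [k l||].
  - case: unliftP => [i ->|->]; case: unliftP => [j ->|->] //.
    + by move/zI ->.
    + by move=> zy; have := yz i; rewrite zy eqxx.
    + by move=> zy; have := yz j; rewrite zy eqxx.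
  - by move=> k; case: unliftP.
  - by move=> k; case: unliftP.
split; first by exists phi.
move=> f fS fext.
have fy : f y = phi y by have := fext ord0; rewrite unlift_none.
have fw i : f (z i) = w i by have := fext (lift ord0 i); rewrite liftK.
(* Since [f y = phi y], [f] is itself a maximizer at [y]. *)
apply: (maximal_norm_oo_eq1 yB zB yz fS) => g gS gf.
by rewrite fy; apply: phimax; split => // i; rewrite gf fw.
Unshelve. all: by end_near. Qed.

End Extremal.

Theorem theorem1 (R : realType) (n m : nat)
    (z : 'I_m -> 'rV[R[i]]_n) (w : 'I_m -> R[i])
    (hn : (1 <= n)%N)
    (hz : injective z)
    (hzB : forall i, unit_ball (z i))
    (hw : forall i, unit_disc (w i))
    (hex : exists f : 'rV[R[i]]_n -> R[i],
       schur_class f /\ (forall i, f (z i) = w i)) :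
  exists phi : 'rV[R[i]]_n -> R[i],
    extremal_functions phi /\ (forall i, phi (z i) = w i).
Proof.
pose i0 : 'I_n := Ordinal hn.
case: m z w hz hzB hw hex => [|m] z w hz hzB hw hex; last first.
  exact: (exists_extremal_interpolant i0 ord0 hz hzB hw hex).
(* Without nodes, interpolate the value 0 at the origin instead. *)
have [||||phi [phiE _]] := @exists_extremal_interpolant R n 1 i0 ord0 (fun=> 0) (fun=> 0).
- by move=> i j _; rewrite !ord1.
- by move=> _; rewrite /unit_ball /mkset big1// => i _; rewrite mxE cmod0 expr0n.
- by move=> _; rewrite /unit_disc /mkset cmod0.
- exists (fun y => (0 : {poly R[i]}).[y 0 i0]); split; last by move=> i; rewrite horner0.
  apply/schur_classP; split=> v _; first exact: analytic_at_horner.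
  by rewrite horner0 cmod0.
by exists phi; split => // -[].
Qed.
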